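(* Let $k$ be an infinite field and let $M$ be a finitely generated graded module over a homogeneous $k$-algebra $R$. If $\mathrm{depth}(M)>0$ and $r=\mathrm{reg}(M)$, then $$\mathrm{bdeg}(M)\le H(M;r),$$ where $H(M;j)=\dim_k M_{\langle j\rangle}$ is the Hilbert function of $M$.
   Context: A homogeneous $k$-algebra is a graded ring $R=\bigoplus_{i\ge 0}R_{\langle i\rangle}$ with $R_{\langle 0\rangle}=k$, $\dim_k R_{\langle 1\rangle}<\infty$, and $R=k[R_{\langle 1\rangle}]$; its irrelevant maximal ideal is $\mathfrak m=\bigoplus_{i\ge1}R_{\langle i\rangle}$. $\mathcal M(R)$ is the category of finitely generated graded $R$-modules; $M_{\langle j\rangle}$ is the degree $j$ component. $\ell$ is length, $\Gamma_{\mathfrak m}(M)=\{z\in M: \mathfrak m^t z=0 \text{ for } t\gg0\}$, and $\deg(M)$ is the multiplicity of $M$ ($=\ell(M)$ if $\dim M=0$). A notion of genericity on $\mathcal M(R)$ is a function $U$ assigning to each isomorphism class of modules $M$ a non-empty subset $U(M)\subseteq R_{\langle1\rangle}$ that contains a nonempty Zariski-open subset of $R_{\langle1\rangle}$ and such that, if $\mathrm{depth}(M)>0$, every $f\in U(M)$ is regular on $M$. The extremal cohomological degree $\mathrm{bdeg}(-)$ is the unique function from isomorphism classes of $\mathcal M(R)$ to $\mathbf N$ for which there is a notion of genericity $U$ such that for all $M$: (1) $\mathrm{bdeg}(M)=\deg(M)$ if $M$ is Cohen-Macaulay; (2) if $L=\Gamma_{\mathfrak m}(M)$, then $\mathrm{bdeg}(M)=\mathrm{bdeg}(M/L)+\ell(L)$;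 (3) if $\mathrm{depth}(M)>0$ and $x\in U(M)$, then $\mathrm{bdeg}(M)=\mathrm{bdeg}(M/xM)$. (Such a function exists and is unique.) Regularity: view $M$ as a graded module over a standard graded polynomial ring $S$ over $k$ mapping onto $R$, with graded Betti numbers $\beta_{ij}$ (the $i$-th module in the minimal graded free $S$-resolution is $\bigoplus_jS[-j]^{\beta_{ij}}$); then $\mathrm{reg}(M)=\max\{j-i:\beta_{ij}\neq0\}$ (independent of $S$). *)

(* Defs.v *)
From HB Require Import structures.
From mathcomp Require Import all_boot all_order all_algebra.
From mathcomp Require Import boolp classical_sets cardinality.
From mathcomp Require Import mpoly.

Set Implicit Arguments.
Unset Strict Implicit.
Unset Printing Implicit Defensive.

Import Order.TTheory GRing.Theory Num.Theory.

Local Open Scope classical_set_scope.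
Local Open Scope ring_scope.

(* The largest element of A; 0 if A is empty or unbounded. *)
Definition natmax (A : set nat) : nat :=
  xget 0%N [set n | A n /\ forall m, A m -> (m <= n)%N].

Section VectorSpaces.
Variables (k : fieldType) (V : lmodType k).

Definition is_basis (P : {pred V}) d (e : 'I_d -> V) : Prop :=
  (forall i, e i \in P) /\
  (forall v, v \in P -> exists! c : 'rV[k]_d, v = \sum_i c 0 i *: e i).

(* The dimension of P over k; 0 if P has no finite basis. *)
Definition vdim (P : {pred V}) : nat :=
  xget 0%N [set d | exists e : 'I_d -> V, is_basis P e].

(* Relatively open subsets of the finite-dimensional space P, identified with
   affine space by the choice of a basis: complements of the common zeros of
   a set of polynomials. *)
Definition zariski_open (P : {pred V}) (O : set V) : Prop :=
  (forall v, O v -> v \in P) /\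
  exists d (e : 'I_d -> V), is_basis P e /\
  exists F : set {mpoly k[d]}, forall c : 'I_d -> k,
    O (\sum_i c i *: e i) <-> exists2 p, F p & p.@[c] != 0.

End VectorSpaces.

(* V is the internal direct sum of the subgroups G i. *)
Definition is_grading (I : eqType) (V : zmodType) (G : I -> {pred V}) : Prop :=
  [/\ forall i, zmod_closed (G i),
      forall x, exists (s : seq I) (c : I -> V),
        (forall i, c i \in G i) /\ x = \sum_(i <- s) c i
    & forall (s : seq I) (c : I -> V), uniq s -> (forall i, c i \in G i) ->
        \sum_(i <- s) c i = 0 -> {in s, forall i, c i = 0}].

(* The value at e of a polynomial with coefficients in k. *)
Definition aeval (k : fieldType) (R : comAlgType k) n (e : 'I_n -> R)
  (p : {mpoly k[n]}) : R := mmap (GRing.in_alg R) e p.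

Record homogAlg (k : fieldType) := HomogAlg {
  hsort :> comAlgType k;
  hcomp : nat -> {pred hsort};
  hcomp_grading : is_grading hcomp;
  hcomp_mul : forall i j x y,
    x \in hcomp i -> y \in hcomp j -> x * y \in hcomp (i + j)%N;
  hcomp0 : forall x, x \in hcomp 0%N <-> exists a : k, x = a%:A;
  hcomp1_fin : exists d (e : 'I_d -> hsort), is_basis (hcomp 1%N) e;
  hcomp1_gen : forall x, exists n (e : 'I_n -> hsort) (p : {mpoly k[n]}),
    (forall i, e i \in hcomp 1%N) /\ x = aeval e p }.

Arguments hcomp {k} h i.

Record gmod (k : fieldType) (R : homogAlg k) := GMod {
  gsort :> lmodType R;
  gcomp : int -> {pred gsort};
  gcomp_grading : is_grading gcomp;
  gcomp_scale : forall (i : nat) (j : int) (a : R) (z : gsort),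
    a \in hcomp R i -> z \in gcomp j -> a *: z \in gcomp (i%:Z + j);
  gmod_fg : exists n (g : 'I_n -> gsort), forall z,
    exists c : 'I_n -> R, z = \sum_i c i *: g i }.

Arguments gcomp {k R} g j.

(* Restriction of scalars along k -> R. *)
Section Restriction.
Variables (k : fieldType) (R : comAlgType k) (M : lmodType R).

Definition kmod : Type := M.

HB.instance Definition _ := GRing.Zmodule.on kmod.

Definition kmod_scale (a : k) (z : kmod) : kmod := (a%:A : R) *: (z : M).

Fact kmod_scaleA a b z :
  kmod_scale a (kmod_scale b z) = kmod_scale (a * b) z.
Proof. by rewrite /kmod_scale scalerA -scalerAl mul1r scalerA. Qed.

Fact kmod_scale1 : left_id 1 kmod_scale.
Proof. by move=> z; rewrite /kmod_scale !scale1r. Qed.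

Fact kmod_scaleDr : right_distributive kmod_scale +%R.
Proof. by move=> a y z; rewrite /kmod_scale scalerDr. Qed.

Fact kmod_scaleDl z : {morph kmod_scale^~ z : a b / a + b}.
Proof. by move=> a b; rewrite /kmod_scale !scalerDl. Qed.

HB.instance Definition _ := GRing.Zmodule_isLmodule.Build k kmod
  kmod_scaleA kmod_scale1 kmod_scaleDr kmod_scaleDl.

End Restriction.

Section GradedModules.
Variables (k : fieldType) (R : homogAlg k).
Implicit Types (M N : gmod R).

Definition hilb M (j : int) : nat := vdim (gcomp M j : {pred kmod M}).

Definition giso M N : Prop :=
  exists f : {linear M -> N}, bijective f /\
    forall j z, z \in gcomp M j -> f z \in gcomp N j.

(* N is isomorphic, as a graded module, to M / K. *)
Definition is_quotient M (K : set M) N : Prop :=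
  exists f : {linear M -> N},
    [/\ forall y, exists z, f z = y,
        forall z, f z = 0 <-> K z
      & forall j z, z \in gcomp M j -> f z \in gcomp N j].

Definition irrelevant : set R :=
  [set x | exists n (c : nat -> R),
    (forall i, c i \in hcomp R i.+1) /\ x = \sum_(i < n) c i].

(* m^t z = 0 is tested on the t-fold products, which generate m^t. *)
Definition Gamma M : set M :=
  [set z | exists t0, forall t, (t0 <= t)%N ->
    forall s : seq R, size s = t -> (forall a, a \in s -> irrelevant a) ->
      (\prod_(a <- s) a) *: z = 0].

(* The length of a submodule K: the maximal length of a strict chain of
   submodules of K (0 if K has infinite length). *)
Definition modlength M (K : set M) : nat :=
  natmax [set n | exists P : nat -> {pred M},
    [/\ forall i, (i <= n)%N -> GRing.submod_closed (P i),
        forall i, (i <= n)%N -> forall z, z \in P i -> K z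
      & forall i, (i < n)%N -> {subset P i <= P i.+1} /\
          exists2 z, z \in P i.+1 & z \notin P i]].

(* The submodule (s_0, ..., s_(n-1)) M. *)
Definition seq_submod M (s : seq R) : set M :=
  [set z | exists c : nat -> M, z = \sum_(i < size s) s`_i *: c i].

Definition regular_elt M (f : R) : Prop := forall z : M, f *: z = 0 -> z = 0.

Definition regular_seq M (s : seq R) : Prop :=
  [/\ forall a, a \in s -> irrelevant a,
      forall i, (i < size s)%N -> forall z : M,
        seq_submod (take i s) (s`_i *: z) -> seq_submod (take i s) z
    & exists z : M, ~ seq_submod s z].

(* The depth is the supremum of the lengths of the M-regular sequences in the
   irrelevant ideal; depth_ge M n says that it is at least n. *)
Definition depth_ge M n : Prop := exists2 s, size s = n & regular_seq M s.

Definition has_depth M d : Prop :=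
  depth_ge M d /\ forall n, depth_ge M n -> (n <= d)%N.

(* The Krull dimension of R / Ann M is the supremum of the lengths of the
   chains of primes of R containing Ann M; idealr_closed requires properness. *)
Definition dim_ge M n : Prop :=
  exists P : nat -> {pred R},
    [/\ forall i, (i <= n)%N -> idealr_closed (P i) /\ prime_idealr_closed (P i),
        forall a : R, (forall z : M, a *: z = 0) -> a \in P 0%N
      & forall i, (i < n)%N -> {subset P i <= P i.+1} /\
          exists2 a, a \in P i.+1 & a \notin P i].

Definition has_dim M d : Prop :=
  dim_ge M d /\ forall n, dim_ge M n -> (n <= d)%N.

(* The zero module, which has neither a depth nor a dimension in the above
   sense, is Cohen-Macaulay by convention. *)
Definition cohen_macaulay M : Prop :=
  (forall z : M, z = 0) \/ exists d, has_depth M d /\ has_dim M d.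

Definition hilbert_poly M (p : {poly rat}) : Prop :=
  exists n0 : nat, forall n : nat, (n0 <= n)%N -> p.[n%:R] = (hilb M n)%:R.

(* deg M = e: the length in dimension <= 0 (the zero module included), and
   otherwise (dim M - 1)! times the leading coefficient of the Hilbert
   polynomial. *)
Definition has_mult M (e : nat) : Prop :=
  (~ dim_ge M 1 /\ e = modlength [set: M]) \/
  exists d p, [/\ has_dim M d.+1, hilbert_poly M p
    & lead_coef p * d`!%:R = e%:R].

Definition genericity (U : gmod R -> set R) : Prop :=
  [/\ forall M N, giso M N -> U M = U N,
      forall M f, U M f -> f \in hcomp R 1%N,
      forall M, exists O : set R,
        [/\ zariski_open (hcomp R 1%N) O, O !=set0 & O `<=` U M]
    & forall M, depth_ge M 1 -> forall f, U M f -> regular_elt M f].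

(* The conditions that determine the extremal cohomological degree among the
   functions of isomorphism classes of graded modules. *)
Definition is_bdeg (b : gmod R -> nat) : Prop :=
  (forall M N, giso M N -> b M = b N) /\
  exists2 U, genericity U &
    [/\ forall M, cohen_macaulay M -> has_mult M (b M),
        forall M N, is_quotient (@Gamma M) N ->
          b M = (b N + modlength (@Gamma M))%N
      & forall M x, depth_ge M 1 -> U M x ->
          forall N, is_quotient (@seq_submod M [:: x]) N -> b M = b N].

(* A complex F_0 <- F_1 <- ... of free modules of finite rank over the
   polynomial ring S in n variables, augmented to M. The a-th basis vector of
   F_i has degree rdeg i a, so F_i is the sum of the S[- rdeg i a]; the
   differentials act on row vectors from the right. *)
Record freecx M n := FreeCx {
  rk : nat -> nat;
  rdeg : forall i, 'I_(rk i) -> int;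
  rgen : 'I_(rk 0) -> M;
  rmx : forall i, 'M[{mpoly k[n]}]_(rk i.+1, rk i) }.

Arguments rk {M n} f i.
Arguments rdeg {M n} f i a.
Arguments rgen {M n} f a.
Arguments rmx {M n} f i.

(* S acts on M through S -> R, 'X_a |-> e a. *)
Definition augment M n (e : 'I_n -> R) (F : freecx M n)
  (v : 'rV[{mpoly k[n]}]_(rk F 0)) : M :=
  \sum_a aeval e (v 0 a) *: rgen F a.

Arguments augment {M n} e F v.

(* Homogeneity of degree 0, exactness, and minimality: the entries of the
   differentials have no constant term. *)
Definition is_minres M n (e : 'I_n -> R) (F : freecx M n) : Prop :=
  [/\ (forall a, rgen F a \in gcomp M (rdeg F 0 a)) /\
      (forall i a c m, m \in msupp (rmx F i a c) ->
         (mdeg m)%:Z = rdeg F i.+1 a - rdeg F i c),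
      forall z, exists v, augment e F v = z,
      forall v, augment e F v = 0 <-> exists w, v = w *m rmx F 0,
      forall i (v : 'rV_(rk F i.+1)),
        v *m rmx F i = 0 <-> exists w, v = w *m rmx F i.+1
    & forall i a c, (rmx F i a c)@_0%MM = 0].

Definition betti M n (F : freecx M n) (i : nat) (j : int) : nat :=
  #|[pred a : 'I_(rk F i) | rdeg F i a == j]|.

(* reg M = r. The zero module, of regularity - infinity, has no such r. *)
Definition has_reg M (r : int) : Prop :=
  exists n (e : 'I_n -> R) (F : freecx M n),
    [/\ (forall a, e a \in hcomp R 1%N) /\ (forall x, exists p, aeval e p = x),
        is_minres e F,
        exists i j, betti F i j != 0%N /\ r = j - i%:Z
      & forall i j, betti F i j != 0%N -> j - i%:Z <= r].

End GradedModules.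

(* Main.v *)
(* Write S = k[X_1, ..., X_n] -> R for the presentation used by reg M.  The
   condition "reg M <= r" enters only through its Koszul form: the Koszul complex
   of M is exact at every weight w > r, the weight being the internal degree
   minus the homological degree.  It follows from the resolution by dimension
   shifting, since the Koszul complex of a free module is exact at weights above
   the degrees of its generators.

   Let x in U(M) be regular on M, N = M / x M, L = Gamma(N) and M' = N / L.  The
   Koszul condition passes from M to N and to M', and it forces L to live in
   degrees <= r.  Hence
     H(M; r) >= sum_(j <= r) H(N; j) = sum_(j <= r) (H(L; j) + H(M'; j))
             >= length L + H(M'; r),
   and by induction this is at least length L + bdeg M' = bdeg M.  The induction
   is on H(M; r + 1), which drops by at least H(M; r) > 0, so no dimension theory
   is needed.  That M' has positive depth when it is not zero needs a regular
   linear form, which comes from the Hilbert basis theorem and from k being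
   infinite. *)

Require Import Defs.
From HB Require Import structures.
From mathcomp Require Import all_boot all_order all_algebra.
From mathcomp Require Import boolp classical_sets cardinality functions.
From mathcomp Require Import mpoly.

Set Implicit Arguments.
Unset Strict Implicit.
Unset Printing Implicit Defensive.

Import Order.TTheory GRing.Theory Num.Theory.

Local Open Scope ring_scope.

(** * Koszul complexes *)

(** Only the inequality reg <= r is carried along, with one and the same r for all modules of the
    induction: M' may have smaller regularity, yet its Hilbert function is still evaluated at r. The
    Koszul form suits this because it passes to quotients by lifting a cycle and correcting its
    boundary, whereas a resolution of M would have to be replaced by new ones for N and M'. For N
    the boundary of the lift is x times a cycle, and x absorbs the rise of weight caused by the
    differential, so exactness at the same weight w applies. For M' it is a torsion chain of weight
    w + 1 > r, hence zero. The two ends of the Koszul complex carry the rest: the top end says that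
    there is no socle in degrees > r, the bottom end that no generators are needed there. The given
    resolution may go on forever; the shifting along it stops because each step lowers the
    homological degree of the Koszul cycle. The form regular on M' only certifies positive depth: in
    the next round x is again taken from U(M'). *)

(* The Koszul complex K(x_0, ..., x_(m-1); V), with differential kd x, as the
   mapping cone of x_(m-1) on K(x_0, ..., x_(m-2); V).  All homological degrees
   are kept together in 2^m copies of V; kfil q says that the chain is supported
   in homological degrees < q. *)
Fixpoint kz (V : zmodType) (m : nat) : zmodType :=
  if m is m'.+1 then (kz V m' * kz V m')%type : zmodType else V.

Fixpoint kall (V : zmodType) (P : V -> Prop) m : kz V m -> Prop :=
  match m return kz V m -> Prop with
  | 0 => P
  | m'.+1 => fun a : kz V m' * kz V m' => kall P a.1 /\ kall P a.2
  end.

Fixpoint kmap (V W : zmodType) (f : V -> W) m : kz V m -> kz W m :=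
  match m return kz V m -> kz W m with
  | 0 => f
  | m'.+1 => fun a : kz V m' * kz V m' => (kmap f a.1, kmap f a.2)
  end.

Fixpoint kd (V : zmodType) (x : nat -> V -> V) m : kz V m -> kz V m :=
  match m return kz V m -> kz V m with
  | 0 => fun=> 0
  | m'.+1 => fun a : kz V m' * kz V m' =>
      (kd x a.1 + kmap (x m') a.2, - kd x a.2)
  end.

Fixpoint kfil (V : zmodType) m : nat -> kz V m -> Prop :=
  match m return nat -> kz V m -> Prop with
  | 0 => fun q a => q = 0%N -> a = 0
  | m'.+1 => fun q (a : kz V m' * kz V m') => kfil q a.1 /\ kfil q.-1 a.2
  end.

(** Homological degree m of the complex is a single copy of V, read by [ktop] and filled by [ktopc];
    [kbotc] fills the single copy in degree 0. Cycles there detect the socle and the generators. *)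
Fixpoint ktop (V : zmodType) m : kz V m -> V :=
  match m return kz V m -> V with
  | 0 => id
  | m'.+1 => fun a : kz V m' * kz V m' => ktop a.2
  end.

Fixpoint ktopc (V : zmodType) m (z : V) : kz V m :=
  match m return kz V m with
  | 0 => z
  | m'.+1 => (0 : kz V m', ktopc m' z)
  end.

Fixpoint kbotc (V : zmodType) m (z : V) : kz V m :=
  match m return kz V m with
  | 0 => z
  | m'.+1 => (kbotc m' z, 0 : kz V m')
  end.

Section Subtractive.
Variables (V W : zmodType) (f : V -> W) (fB : {morph f : a b / a - b}).

Lemma morphB0 : f 0 = 0.
Proof. by rewrite -(subrr 0) fB subrr. Qed.

Lemma morphBN : {morph f : a / - a}.
Proof. by move=> a; rewrite -[- a]sub0r fB morphB0 sub0r. Qed.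

Lemma morphBD : {morph f : a b / a + b}.
Proof. by move=> a b; rewrite -[b in LHS]opprK fB morphBN opprK. Qed.

Lemma kmapB m : {morph @kmap V W f m : a b / a - b}.
Proof. by elim: m => [|m IH] //= [a b] [c d] /=; rewrite !IH. Qed.

End Subtractive.

Section SubtractiveKmap.
Variables (V W : zmodType) (f : V -> W) (fB : {morph f : a b / a - b}).

Lemma kmap0 m : kmap f (0 : kz V m) = 0.
Proof. exact: (morphB0 (kmapB fB (m := m))). Qed.

Lemma kmapN m : {morph @kmap V W f m : a / - a}.
Proof. exact: (morphBN (kmapB fB (m := m))). Qed.

Lemma kmapD m : {morph @kmap V W f m : a b / a + b}.
Proof. exact: (morphBD (kmapB fB (m := m))). Qed.

End SubtractiveKmap.

Lemma kmap_comp (V1 V2 V3 : zmodType) (f : V2 -> V3) (g : V1 -> V2) m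
  (a : kz V1 m) : kmap f (kmap g a) = kmap (f \o g) a.
Proof. by elim: m a => //= m IH a; rewrite !IH. Qed.

Lemma eq_kmap (V W : zmodType) (f g : V -> W) m (a : kz V m) :
  f =1 g -> kmap f a = kmap g a.
Proof. by move=> fg; elim: m a => //= m IH a; rewrite !IH. Qed.

Lemma kmap_id (V : zmodType) m (a : kz V m) : kmap id a = a.
Proof. by elim: m a => //= m IH [a b] /=; rewrite !IH. Qed.

Lemma kmap_sub (V W : zmodType) (f g : V -> W) m (a : kz V m) :
  kmap (fun v => f v - g v) a = kmap f a - kmap g a.
Proof. by elim: m a => //= m IH a; rewrite !IH. Qed.

Section Kall.
Variables (V W : zmodType).

Lemma kall_impl (P Q : V -> Prop) m (a : kz V m) :
  (forall v, P v -> Q v) -> kall P a -> kall Q a.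
Proof.
by move=> PQ; elim: m a => [|m IH a /= [/IH ? /IH]] //; exact: PQ.
Qed.

Lemma kall_map (f : V -> W) (P : W -> Prop) m (a : kz V m) :
  kall P (kmap f a) <-> kall (fun v => P (f v)) a.
Proof. by elim: m a => //= m IH a; rewrite !IH. Qed.

Lemma kall_and (P Q : V -> Prop) m (a : kz V m) :
  kall P a -> kall Q a -> kall (fun v => P v /\ Q v) a.
Proof. by elim: m a => //= m IH a [? ?] [? ?]; split; apply: IH. Qed.

Lemma kall0 (P : V -> Prop) m : P 0 -> kall P (0 : kz V m).
Proof. by move=> P0; elim: m. Qed.

Lemma kallB (P : V -> Prop) : (forall a b, P a -> P b -> P (a - b)) ->
  forall m (a b : kz V m), kall P a -> kall P b -> kall P (a - b).
Proof.
move=> PB; elim=> [a b|m IH [a b] [c d]] /=; first exact: PB.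
by case=> ? ? [? ?]; split; apply: IH.
Qed.

Lemma kall_eq0 m (a : kz V m) : kall (fun v => v = 0) a -> a = 0.
Proof. by elim: m a => //= m IH [a b] /= [/IH-> /IH->]. Qed.

(* Componentwise choice of preimages; the preimage of 0 is 0, so that supports
   are preserved. *)
Lemma kmap_lift (f : V -> W) (P : V -> Prop) (Q : W -> Prop) m (a : kz W m) :
    f 0 = 0 -> P 0 -> (forall w, Q w -> exists2 v, P v & f v = w) ->
  kall Q a -> exists b : kz V m,
    [/\ kall P b, kmap f b = a & forall q, kfil q a -> kfil q b].
Proof.
move=> f0 P0 lift; elim: m a => [a Qa|m IH [a1 a2] /= [/IH[b1 [Pb1 <- fil1]]]].
  have [->|a0] := eqVneq a 0; first by exists 0.
  have [v Pv fv] := lift _ Qa; exists v; split=> // q /= fa q0.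
  by rewrite fa // eqxx in a0.
move=> /IH[b2 [Pb2 <- fil2]]; exists (b1, b2); split=> //= q [? ?].
by split; [apply: fil1 | apply: fil2].
Qed.

Lemma kall_lift (f : V -> W) (P : V -> Prop) (Q : W -> Prop) m (a : kz W m) :
    (forall w, Q w -> exists2 v, P v & f v = w) ->
  kall Q a -> exists2 b : kz V m, kall P b & kmap f b = a.
Proof.
move=> lift; elim: m a => [a /lift[v]|m IH [a1 a2] /=]; first by exists v.
by case=> /IH[b1 ? <-] /IH[b2 ? <-]; exists (b1, b2).
Qed.

Lemma kfil0 m (a : kz V m) : kfil 0 a -> a = 0.
Proof. by elim: m a => [a|m IH [a b] /= [/IH-> /IH->]] //=; apply. Qed.

Lemma kfil_zero m q : kfil q (0 : kz V m).
Proof. by elim: m q => //= m IH q; split; apply: IH. Qed.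

Lemma kfilB m q (a b : kz V m) : kfil q a -> kfil q b -> kfil q (a - b).
Proof.
elim: m q a b => [|m IH] q a b /=.
  by move=> fa fb q0; rewrite fa // fb // subrr.
by case=> ? ? [? ?]; split; apply: IH.
Qed.

Lemma kfil_map (f : V -> W) m q (a : kz V m) :
  f 0 = 0 -> kfil q a -> kfil q (kmap f a).
Proof.
move=> f0; elim: m q a => [|m IH] q a /=; first by move=> fa /fa->.
by case=> ? ?; split; apply: IH.
Qed.

Lemma kfil_full m (a : kz V m) : kfil m.+1 a.
Proof.
have fil_gt : forall q, (m < q)%N -> kfil q a; last exact: fil_gt.
elim: m a => [a [] //|m IH a [//|q] lt_mq] /=.
by split; apply: IH => //; apply: leqW.
Qed.

End Kall.

Lemma ktopc0 (V : zmodType) m : ktopc m 0 = 0 :> kz V m.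
Proof. by elim: m => //= m ->. Qed.

Lemma kmap_topc (V W : zmodType) (f : V -> W) m z :
  {morph f : a b / a - b} -> kmap f (ktopc m z) = ktopc m (f z).
Proof. by move=> fB; elim: m => //= m ->; rewrite kmap0. Qed.

Lemma kall_topc (V : zmodType) (P : V -> Prop) m z :
  P 0 -> P z -> kall P (ktopc m z).
Proof. by move=> P0 Pz; elim: m => //= m IH; split; first exact: kall0. Qed.

Lemma ktopcK (V : zmodType) m : cancel (@ktopc V m) (@ktop V m).
Proof. by elim: m. Qed.

Lemma kall_botc (V : zmodType) (P : V -> Prop) m z :
  P 0 -> P z -> kall P (kbotc m z).
Proof. by move=> P0 Pz; elim: m => //= m IH; split; last exact: kall0. Qed.

Lemma kbotc_inj (V : zmodType) m z : kbotc m z = 0 :> kz V m -> z = 0.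
Proof. by elim: m => //= m IH [/IH]. Qed.

Section Differential.
Variables (V : zmodType) (x : nat -> V -> V).
Hypothesis xB : forall i, {morph x i : a b / a - b}.

Lemma kdB m : {morph @kd V x m : a b / a - b}.
Proof.
elim: m => [a b|m IH [a b] [c d]] /=; first by rewrite subrr.
have pairB (p q : kz V m * kz V m) : p - q = (p.1 - q.1, p.2 - q.2) by [].
rewrite [RHS]pairB /= !IH kmapB // !opprD; congr pair.
by rewrite addrACA.
Qed.

Lemma kd0 m : kd x (0 : kz V m) = 0.
Proof. exact: (morphB0 (kdB (m := m))). Qed.

Lemma kdN m : {morph @kd V x m : a / - a}.
Proof. exact: (morphBN (kdB (m := m))). Qed.

Lemma kdD m : {morph @kd V x m : a b / a + b}.
Proof. exact: (morphBD (kdB (m := m))). Qed.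

Lemma kfil_kd m q (a : kz V m) : kfil q.+1 a -> kfil q (kd x a).
Proof.
elim: m q a => [|m IH] q /=; first by move=> a _ _.
case=> a b /= [fa fb].
split; first rewrite -[kmap _ _]opprK; first apply: kfilB; first exact: IH.
  rewrite -sub0r; apply: kfilB; first exact: kfil_zero.
  by apply: kfil_map => //; apply: morphB0.
rewrite -sub0r; apply: kfilB; first exact: kfil_zero.
case: q fb fa => [/kfil0-> _|q fb _]; last exact: IH.
by rewrite kd0; apply: kfil_zero.
Qed.

(** There are no chains in homological degree m + 1, so a boundary has nothing in degree m. *)
Lemma ktop_kd m (a : kz V m) : ktop (kd x a) = 0.
Proof.
have topN k (b : kz V k) : ktop (- b) = - ktop b.
  by elim: k b => //= k IH b; apply: IH.
by elim: m a => //= m IH a; rewrite topN IH oppr0.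
Qed.

Lemma kd_topc m z : (forall i, (i < m)%N -> x i z = 0) -> kd x (ktopc m z) = 0.
Proof.
elim: m => //= m IH xz; rewrite IH; last by move=> i im; apply/xz/leqW.
by rewrite kd0 add0r oppr0 kmap_topc // xz // ktopc0.
Qed.

Lemma kd_botc m z : kd x (kbotc m z) = 0.
Proof. by elim: m => //= m ->; rewrite kmap0 // kd0 add0r oppr0. Qed.

Lemma kall_kd (P Q : V -> Prop) m (a : kz V m) :
    Q 0 -> (forall a b, Q a -> Q b -> Q (a - b)) ->
    (forall i v, P v -> Q (x i v)) ->
  kall P a -> kall Q (kd x a).
Proof.
move=> Q0 QB xPQ; elim: m a => [|m IH] a //= [/IH Qa1 Pa2].
have Qx : kall Q (kmap (x m) a.2).
  by apply/kall_map; apply: kall_impl Pa2 => v; apply: xPQ.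
split; last by rewrite -sub0r; apply: kallB; [|apply: kall0|apply: IH].
rewrite -[kmap _ _]opprK; apply: kallB => //.
by rewrite -sub0r; apply: kallB => //; apply: kall0.
Qed.

Lemma kd_map (f : V -> V) m (a : kz V m) : {morph f : a b / a - b} ->
    (forall i v, (i < m)%N -> f (x i v) = x i (f v)) ->
  kd x (kmap f a) = kmap f (kd x a).
Proof.
move=> fB; elim: m a => /= [|m IH] a fx; first by rewrite morphB0.
rewrite !IH; try by move=> i v im; apply/fx/leqW.
rewrite kmapD // kmapN // !kmap_comp; congr pair; congr (_ + _); apply: eq_kmap => v /=.
by rewrite fx.
Qed.

Hypothesis xC : forall i j v, x i (x j v) = x j (x i v).

Lemma kdd m (a : kz V m) : kd x (kd x a) = 0.
Proof.
elim: m a => //= m IH a; rewrite kdD kdN !IH oppr0 add0r.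
by rewrite kd_map // kmapN // addrN oppr0.
Qed.

End Differential.

Lemma kd_kmap (V W : zmodType) (x : nat -> V -> V) (y : nat -> W -> W)
    (f : V -> W) m (a : kz V m) :
    {morph f : a b / a - b} -> (forall i v, f (x i v) = y i (f v)) ->
  kd y (kmap f a) = kmap f (kd x a).
Proof.
move=> fB fx; elim: m a => /= [|m IH] a; first by rewrite morphB0.
rewrite !IH kmapD // kmapN // !kmap_comp; congr pair; congr (_ + _).
by apply: eq_kmap => v /=.
Qed.

(* Exactness of the n-variable Koszul complex at weight w, the weight being the
   internal degree minus the homological degree: all 2^n components of a chain
   of weight w lie in G w. *)
Definition kexact (V : zmodType) (x : nat -> V -> V) (G : int -> V -> Prop) n w :=
  forall a : kz V n, kall (G w) a -> kd x a = 0 ->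
    exists2 b, kall (G (w - 1)) b & kd x b = a.

(* The same for cycles supported in homological degrees < q. *)
Definition kfexact (V : zmodType) (x : nat -> V -> V) (G : int -> V -> Prop) n q w :=
  forall a : kz V n, kall (G w) a -> kfil q a -> kd x a = 0 ->
    exists2 b, kall (G (w - 1)) b & kd x b = a.

Section DimensionShift.
Variables (V W : zmodType) (x : nat -> V -> V) (y : nat -> W -> W) (f : V -> W).
Variables (G : int -> V -> Prop) (H : int -> W -> Prop) (n q : nat) (w : int).
Hypothesis xB : forall i, {morph x i : a b / a - b}.
Hypothesis xC : forall i j v, x i (x j v) = x j (x i v).
Hypothesis fB : {morph f : a b / a - b}.
Hypothesis fx : forall i v, f (x i v) = y i (f v).
Hypothesis G0 : forall j, G j 0.
Hypothesis GB : forall j a b, G j a -> G j b -> G j (a - b).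
Hypothesis xG : forall i j v, G j v -> G (j + 1) (x i v).
Hypothesis fG : forall j v, G j v -> H j (f v).
Hypothesis lift : forall v, H w v -> exists2 u, G w u & f u = v.

(** The connecting map of 0 -> ker f -> V -> W -> 0, as a chase: the boundary of a lift b of the
    cycle lies in ker f, one homological degree lower and one weight higher. There it bounds some c,
    so b - c is a cycle of V; it bounds u, and f u bounds the given cycle. *)
Lemma dimension_shift :
    kexact x G n w -> kfexact x (fun j v => G j v /\ f v = 0) n q (w + 1) ->
  kfexact y H n q.+1 w.
Proof.
move=> exV exK a Ha fila da.
have [b [Gb fb filb]] := kmap_lift (morphB0 fB) (G0 w) lift Ha.
have [|||c Gc dc] := exK (kd x b).
- apply: kall_and; first by apply: kall_kd (G0 _) (GB (j := _)) (fun i => @xG i w) Gb.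
  apply/(kall_map f (fun v => v = 0)).
  by rewrite -(kd_kmap _ fB fx) fb da; apply: kall0.
- by apply: kfil_kd => //; apply: filb.
- exact: kdd.
have fc : kmap f c = 0.
  apply/kall_eq0/kall_map; apply: kall_impl Gc => v; exact: proj2.
have [||u Gu du] := exV (b - c).
- by apply: (kallB (GB (j := w))) => //; apply: kall_impl Gc => v []; rewrite addrK.
- by rewrite kdB // dc subrr.
exists (kmap f u); first by apply/kall_map; apply: kall_impl Gu => v; apply: fG.
by rewrite (kd_kmap _ fB fx) du kmapB // fb fc subr0.
Qed.

End DimensionShift.

(** * Acyclicity of the Koszul complex over a polynomial ring *)

Section Acyclic.
Variables (V : zmodType) (x D : nat -> V -> V) (n : nat).
Variables (G : int -> V -> Prop) (w : int).
Hypothesis xB : forall i, {morph x i : a b / a - b}.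
Hypothesis xC : forall i j v, x i (x j v) = x j (x i v).
Hypothesis DB : forall i, {morph D i : a b / a - b}.
Hypothesis DxK : forall i v, (i < n)%N -> D i (x i v) = v.
Hypothesis Dx : forall i j v, i <> j -> D i (x j v) = x j (D i v).
Hypothesis DC : forall i j v, D i (D j v) = D j (D i v).
Hypothesis G0 : forall j, G j 0.
Hypothesis GB : forall j a b, G j a -> G j b -> G j (a - b).
Hypothesis xG : forall i j v, G j v -> G (j + 1) (x i v).
Hypothesis DG : forall i j v, G j v -> G (j - 1) (D i v).
Hypothesis Gconst : forall v, G w v -> (forall i, (i < n)%N -> D i v = 0) -> v = 0.

(* D i is a contracting homotopy for the factor of the i-th variable, up to the
   projection v |-> v - x i (D i v) onto what does not involve that variable. *)
Lemma acyclic : kexact x G n w.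
Proof.
(* The coefficients do not involve the variables of index >= m. Each step projects one more variable
   away; at m = 0 they are constants, which vanish in degree w by [Gconst]. *)
suff main m : (m <= n)%N -> forall a : kz V m, kall (G w) a ->
    kall (fun v => forall i, (m <= i < n)%N -> D i v = 0) a -> kd x a = 0 ->
    exists2 b, kall (G (w - 1)) b & kd x b = a.
  move=> a Ga; apply: main => //; apply: kall_impl Ga => v _ i.
  by rewrite ltnNge; case: leqP.
elim: m => [|m IH] lt_mn /=.
  by move=> a Ga Da _; exists 0; rewrite ?(Gconst Ga Da) //; apply: G0.
case=> a b /= [Ga Gb] [Da Db] [] /eqP; rewrite addr_eq0 => /eqP da /eqP.
rewrite oppr_eq0 => /eqP db.
have D_d (c : kz V m) : kd x (kmap (D m) c) = kmap (D m) (kd x c).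
  apply: kd_map => // i v im; apply: Dx => mi.
  by rewrite mi ltnn in im.
have Dxm : kmap (D m) (kmap (x m) b) = b.
  by rewrite kmap_comp -[RHS]kmap_id; apply: eq_kmap => v /=; apply: DxK.
(* The cycle (a, b) will be the boundary of (c, Dma). The second component is right by [dDma]; for
   the first, c must bound a - x_m Dma, the projection of a to what does not involve the m-th
   variable. *)
set Dma := kmap (D m) a.
have dDma : kd x Dma = - b by rewrite D_d da kmapN // Dxm.
have GDma : kall (G (w - 1)) Dma.
  by apply/kall_map; apply: kall_impl Ga => v; apply: DG.
have [|||c Gc dc] := IH (ltnW lt_mn) (a - kmap (x m) Dma).
- apply: (kallB (GB (j := w))) => //; apply/kall_map; apply: kall_impl GDma => v /(xG m).
  by rewrite subrK.
- have: kall (fun v => D m (v - x m (D m v)) = 0 /\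
               forall i, (m < i < n)%N -> D i (v - x m (D m v)) = 0) a.
    apply: kall_impl Da => v Dv; split=> [|i mi].
      by rewrite DB DxK // subrr.
    have im : i <> m by move=> im; rewrite im ltnn in mi.
    by rewrite DB (Dx _ im) DC (Dv i mi) (morphB0 (DB m)) (morphB0 (xB m)) subrr.
  have <- : kmap (fun v => v - x m (D m v)) a = a - kmap (x m) Dma.
    by rewrite kmap_comp -[X in X - _]kmap_id -kmap_sub.
  move=> Da'; apply/kall_map; apply: kall_impl Da' => v [Dm0 Di] i /andP[].
  by rewrite leq_eqVlt => /predU1P[<-|mi lt_in] //; apply: Di; rewrite mi.
- by rewrite kdB // kd_map // dDma kmapN // da opprK addNr.
exists (c, Dma); first by [].
by rewrite /= dc dDma subrK opprK.
Qed.

End Acyclic.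

(** * Noetherian modules *)

Lemma homo_strict (f : nat -> nat) :
  (forall i, f i < f i.+1)%N -> forall i j, (i < j)%N -> (f i < f j)%N.
Proof.
move=> fS i j; elim: j => // j IH; rewrite ltnS leq_eqVlt.
by case/predU1P=> [->//|/IH lt_ij]; apply: ltn_trans (fS j).
Qed.

(** Each index is a place where f attains its minimum over the tail behind the previous index. *)
Lemma nondecreasing_subseq (f : nat -> nat) : exists2 s : nat -> nat,
  (forall i j, i < j -> s i < s j)%N &
  (forall i j, i <= j -> f (s i) <= f (s j))%N.
Proof.
have minf N : exists m, (N <= m)%N /\ forall m', (N <= m')%N -> (f m <= f m')%N.
  have exv : exists v, `[< exists2 m, (N <= m)%N & f m = v >].
    by exists (f N); apply/asboolP; exists N.
  case: (ex_minnP exv) => v /asboolP[m le_Nm <-] vmin; exists m; split=> // m' Nm'.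
  by apply: vmin; apply/asboolP; exists m'.
have [g gP] := choice minf.
pose s := fix s i := if i is i'.+1 then g (s i').+1 else g 0%N.
have sS i : (s i < s i.+1)%N by have [] := gP (s i).+1.
have s_mono := homo_strict sS.
exists s => // i j; rewrite leq_eqVlt => /predU1P[->//|/s_mono lt_s].
case: i lt_s => [|i] lt_s; apply: (proj2 (gP _)) => //.
by apply: leq_trans (ltnW lt_s); have [] := gP (s i).+1.
Qed.

(** Along a common subsequence neither g nor B - g decreases; the bound keeps the truncated
    subtraction order-reversing. *)
Lemma constant_subseq (g : nat -> nat) B : (forall j, g j < B)%N ->
  exists2 s : nat -> nat, (forall i j, i < j -> s i < s j)%N &
    forall j, g (s j) = g (s 0%N).
Proof.
move=> gB; have [s s_mono gs] := nondecreasing_subseq g.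
have [t t_mono gt] := nondecreasing_subseq (fun i => B - g (s i))%N.
exists (s \o t) => [i j /t_mono/s_mono//|j]; apply/eqP; rewrite eqn_leq /=.
have le_t : (t 0 <= t j)%N by case: j => // j; apply/ltnW/t_mono.
apply/andP; split; last exact: gs.
by have := gt 0%N j (leq0n _); rewrite leq_sub2lE ?(ltnW (gB _)).
Qed.

(** One exponent after another is made nondecreasing along a subsequence. *)
Lemma dickson n (f : nat -> 'X_{1..n}) :
  exists i j, (i < j)%N /\ (f i <= f j)%MM.
Proof.
suff main m : (m <= n)%N -> exists2 s : nat -> nat,
    (forall i j, i < j -> s i < s j)%N &
    forall i j (l : 'I_n), (i <= j)%N -> (l < m)%N -> (f (s i) l <= f (s j) l)%N.
  have [s s_mono fs] := main n (leqnn n).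
  exists (s 0%N), (s 1%N); split; first exact: s_mono.
  by apply/mnm_lepP => l; apply: fs.
elim: m => [|m IH] lt_mn; first by exists id.
have [s s_mono fs] := IH (ltnW lt_mn).
have [t t_mono ft] := nondecreasing_subseq (fun i => f (s i) (Ordinal lt_mn)).
exists (s \o t) => [i j /t_mono/s_mono//|i j l le_ij].
have le_t : (t i <= t j)%N.
  by move: le_ij; rewrite leq_eqVlt => /predU1P[->//|/t_mono/ltnW].
rewrite ltnS leq_eqVlt => /predU1P[lm|]; last exact: fs.
by have -> : l = Ordinal lt_mn by [apply: val_inj]; apply: ft.
Qed.

Definition submodule (R : pzRingType) (V : lmodType R) (K : V -> Prop) :=
  [/\ K 0, forall a b, K a -> K b -> K (a - b) & forall r a, K a -> K (r *: a)].

Section Submodule.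
Variables (R : pzRingType) (V : lmodType R) (K : V -> Prop).
Hypothesis KP : submodule K.

Lemma submod0 : K 0. Proof. by case: KP. Qed.

Lemma submodB a b : K a -> K b -> K (a - b). Proof. by case: KP => _ + _; apply. Qed.

Lemma submodZ r a : K a -> K (r *: a). Proof. by case: KP => _ _; apply. Qed.

Lemma submodD a b : K a -> K b -> K (a + b).
Proof.
move=> Ka Kb; rewrite -[b]opprK -[- b]sub0r.
by do !apply: submodB => //; apply: submod0.
Qed.

Lemma submod_sum I (s : seq I) (c : I -> V) :
  (forall i, K (c i)) -> K (\sum_(i <- s) c i).
Proof.
by move=> Kc; elim/big_ind: _ => //; [exact: submod0 | exact: submodD].
Qed.

End Submodule.

Definition acc (R : pzRingType) (V : lmodType R) := forall U : nat -> V -> Prop,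
  (forall i, submodule (U i)) -> (forall i z, U i z -> U i.+1 z) ->
  exists J, forall j z, (J <= j)%N -> U j z -> U J z.

Lemma chain_mono (T : Type) (U : nat -> T -> Prop) :
  (forall i z, U i z -> U i.+1 z) ->
  forall i j z, (i <= j)%N -> U i z -> U j z.
Proof.
move=> US i j z; elim: j => [|j IH]; first by rewrite leqn0 => /eqP->.
by rewrite leq_eqVlt => /predU1P[->//|/IH Uj /Uj]; apply: US.
Qed.

Section NoetherianPolynomials.
Variables (k : fieldType) (n : nat).
Local Notation S := {mpoly k[n]}.

Lemma mlead_reduce (p q : S) : p != 0 -> (mlead p <= mlead q)%MM ->
  exists a : S, q - a * p = 0 \/ (mlead (q - a * p) < mlead q)%O.
Proof.
move=> p0 le_pq.
pose a : S := (q@_(mlead q) / p@_(mlead p)) *: 'X_[mlead q - mlead p].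
exists a; set h := q - _; have [->|h0] := eqVneq h 0; [by left|right].
have ap : (a * p)@_(mlead q) = q@_(mlead q).
  rewrite -scalerAl mcoeffZ [_ * p]mulrC -{2}(submK le_pq) mcoeffMX.
  by rewrite divfK // mleadc_eq0.
rewrite lt_neqAle; apply/andP; split.
  apply: contraNneq h0 => hq; rewrite -mleadc_eq0 hq mcoeffB ap subrr //.
apply: le_trans (mleadB_le _ _) _; rewrite leUx lexx /=.
rewrite -scalerAl; apply: le_trans (mleadZ_le _ _) _.
apply: le_trans (mleadM_le _ _) _.
by rewrite mleadXm submK.
Qed.

Lemma mlead_min (P : S -> Prop) : (exists p, P p) ->
  exists2 p, P p & forall q, P q -> (mlead p <= mlead q)%O.
Proof.
move=> [p Pp]; have [m] := ex_intro (fun m => m = mlead p) _ erefl.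
elim/(well_founded_ind (@ltom_wf n)): m p Pp => m IH p Pp mE.
have [minp|] := pselect (forall q, P q -> (mlead p <= mlead q)%O); first by exists p.
move=> /existsNP[q /not_implyP[Pq /negP]]; rewrite -ltNge => lt_qp.
by apply: (IH (mlead q)) Pq _ => //; rewrite mE.
Qed.

(** If the chain never stops, take repeatedly an element outside the current ideal but in a later
    one, with least leading monomial. By Dickson some leading monomial divides a later one; reducing
    the later element by the earlier keeps it outside its ideal but lowers its leading monomial,
    against minimality. *)
Lemma acc_mpoly : acc S^o.
Proof.
move=> U Usub US; apply: contrapT => /forallNP noJ.
have next J : exists p, (exists2 j, (J <= j)%N & U j p) /\ ~ U J p.
  have /existsNP[j /existsNP[p /not_implyP[Jj /not_implyP[Uj nU]]]] := noJ J.
  by exists p; split=> //; exists j.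
have {}next J := mlead_min (next J).
have {}next J : exists jp : nat * S, [/\ (J <= jp.1)%N, U jp.1 jp.2, ~ U J jp.2 &
    forall j q, (J <= j)%N -> U j q -> ~ U J q -> (mlead jp.2 <= mlead q)%O].
  have [p [[j Jj Uj] nU] minp] := next J; exists (j, p); split=> // j' q Jj' Uq nUq.
  by apply: minp; split=> //; exists j'.
have [g gP] := choice next.
pose J := fix J i := if i is i'.+1 then (g (J i')).1 else 0%N.
pose p i := (g (J i)).2.
have J_mono i j : (i <= j)%N -> (J i <= J j)%N.
  elim: j => [|j IH]; first by rewrite leqn0 => /eqP->.
  rewrite leq_eqVlt => /predU1P[->//|/IH le_ij]; apply: leq_trans le_ij _.
  by have [] := gP (J j).
have [i [j [lt_ij le_p]]] := dickson (fun i => mlead (p i)).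
have [_ Ui nUi _] := gP (J i); have [le_J Uj nUj minj] := gP (J j).
have p0 : p i != 0.
  apply: contra_not_neq nUi => p0; rewrite -/(p i) p0.
  exact: (submod0 (Usub _)).
have [a] := mlead_reduce p0 le_p.
have Upi : U (J j) (p i) by apply: (chain_mono US) Ui; apply: (J_mono i.+1).
have Ua : U (J j) (a * p i) by apply: (submodZ (Usub _) a Upi).
have nUh : ~ U (J j) (p j - a * p i).
  by move=> /(submodD (Usub _))/(_ Ua); rewrite subrK.
case=> [h0|]; first by apply: nUh; rewrite h0; exact: (submod0 (Usub _)).
apply/negP; rewrite -leNgt; apply: (minj (g (J j)).1) => //.
by apply: (submodB (Usub _)) => //; apply: (chain_mono US) Ua.
Qed.

End NoetherianPolynomials.

(** Induction on the number m of generators in use. The chain stabilises on the span of the first m,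
    and so do the ideals of coefficients that occur at the next generator. *)
Lemma acc_fg (S : pzRingType) (R : pzRingType) (phi : {rmorphism S -> R})
    (V : lmodType R) q (g : 'I_q -> V) :
    (forall r, exists a, phi a = r) ->
    (forall z, exists c : 'I_q -> R, z = \sum_i c i *: g i) ->
  acc S^o -> acc V.
Proof.
move=> phi_surj gen accS U Usub US.
pose span m z := exists c : 'I_q -> R, z = \sum_(i < q | (i < m)%N) c i *: g i.
have spanP m : submodule (span m).
  split=> [|_ _ [c ->] [d ->]|r _ [c ->]].
  - by exists (fun=> 0); rewrite big1 // => i _; rewrite scale0r.
  - exists (fun i => c i - d i); rewrite -sumrB; apply: eq_bigr => i _.
    by rewrite scalerBl.
  exists (fun i => r * c i); rewrite scaler_sumr; apply: eq_bigr => i _.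
  by rewrite scalerA.
suff main m : (m <= q)%N ->
    exists J, forall j z, (J <= j)%N -> U j z -> span m z -> U J z.
  have [J JP] := main q (leqnn q); exists J => j z Jj Uz; apply: JP Uz _ => //.
  have [c ->] := gen z; exists c; apply: eq_big => // i; by rewrite ltn_ord.
elim: m => [|m IH] lt_mq.
  exists 0%N => j z _ _ [c ->]; rewrite big_pred0 //; exact: submod0.
have [J1 J1P] := IH (ltnW lt_mq); set gm := g (Ordinal lt_mq).
(* Coefficients of [gm] in [U j], pulled back to S. Once they are stable, an element of [U j]
   differs from one of [U J2] by an element of [span m]. *)
pose L j (a : S^o) := exists2 y, span m y & U j (phi a *: gm + y).
have [||J2 J2P] := accS L.
- move=> j; split=> [|a b [y ys Uy] [y' ys' Uy']|r a [y ys Uy]].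
  + exists 0; first exact: submod0.
    by rewrite rmorph0 scale0r addr0; apply: submod0.
  + exists (y - y'); first exact: submodB.
    rewrite rmorphB scalerBl addrACA -opprD; exact: submodB.
  exists (phi r *: y); first exact: submodZ.
  rewrite [phi (r *: a)]rmorphM -scalerA -scalerDr; exact: submodZ.
- by move=> j a [y ys Uy]; exists y => //; apply: US.
exists (maxn J1 J2) => j z; rewrite geq_max => /andP[J1j J2j] Uz [c].
rewrite (bigD1 (Ordinal lt_mq)) //= => zE.
have ys : span m (\sum_(i < q | (i < m)%N) c i *: g i) by exists c.
have yE : \sum_(i < q | (i < m.+1)%N && (i != Ordinal lt_mq)) c i *: g i =
          \sum_(i < q | (i < m)%N) c i *: g i.
  by apply: eq_bigl => i; rewrite -val_eqE /= ltnS ltn_neqAle andbC.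
rewrite yE in zE; have [a aE] := phi_surj (c (Ordinal lt_mq)).
have [|y' ys' Uy'] := J2P j a J2j.
  by exists (\sum_(i < q | (i < m)%N) c i *: g i) => //; rewrite aE -zE.
have Umax J z' : (J <= maxn J1 J2)%N -> U J z' -> U (maxn J1 J2) z'.
  exact: chain_mono.
have {}Uy' := Umax _ _ (leq_maxr _ _) Uy'.
rewrite -[z](subrK (phi a *: gm + y')); apply: submodD => //.
apply: Umax (leq_maxl J1 J2) _; apply: (J1P j) => //.
  apply: submodB => //; apply: (chain_mono US) Uy'.
  by rewrite geq_max J1j.
rewrite zE aE -/gm opprD addrACA subrr add0r; exact: (submodB (spanP m)).
Qed.

(** * Dimensions of subspaces *)

Section LinearAlgebra.
Variable k : fieldType.
Implicit Types (V W : lmodType k).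

Definition lincomb V d (c : 'rV[k]_d) (e : 'I_d -> V) := \sum_i c 0 i *: e i.

Definition lin_free V d (e : 'I_d -> V) :=
  forall c : 'rV[k]_d, lincomb c e = 0 -> c = 0.

(** The spanning vectors need not lie in P, so the bound passes to subspaces unchanged. *)
Definition spannable V (P : V -> Prop) d := exists e : 'I_d -> V,
  forall v, P v -> exists c : 'rV[k]_d, v = lincomb c e.

Definition subspace V (P : V -> Prop) :=
  [/\ P 0, forall u v, P u -> P v -> P (u + v) & forall a v, P v -> P (a *: v)].

Definition famcat V a b (e : 'I_a -> V) (f : 'I_b -> V) (i : 'I_(a + b)) : V :=
  match fintype.split i with inl j => e j | inr j => f j end.

Lemma lincomb_cat V a b (e : 'I_a -> V) (f : 'I_b -> V) (c : 'rV[k]_(a + b)) :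
  lincomb c (famcat e f) = lincomb (lsubmx c) e + lincomb (rsubmx c) f.
Proof.
rewrite /lincomb big_split_ord /=; congr (_ + _); apply: eq_bigr => i _.
  by rewrite mxE /famcat (unsplitK (inl i)).
by rewrite mxE /famcat (unsplitK (inr i)).
Qed.

Lemma lin_free_le V d d' (f : 'I_d -> V) (e : 'I_d' -> V) :
  lin_free f -> (forall i, exists c, f i = lincomb c e) -> (d <= d')%N.
Proof.
move=> free_f /choice[A fA]; pose B := \matrix_(i, j) A i 0 j.
suff /eqP : row_free B by move=> <-; apply: rank_leq_col.
rewrite -kermx_eq0; apply/eqP/row_matrixP => i; rewrite row0.
set u := row i _; have uB : u *m B = 0 by rewrite /u -row_mul mulmx_ker row0.
apply: free_f; rewrite /lincomb.
transitivity (\sum_j (u *m B) 0 j *: e j); last first.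
  by rewrite uB big1 // => j _; rewrite mxE scale0r.
under [RHS]eq_bigr do rewrite mxE scaler_suml.
rewrite exchange_big /=; apply: eq_bigr => l _; rewrite fA /lincomb scaler_sumr.
by apply: eq_bigr => j _; rewrite scalerA !mxE.
Qed.

Lemma lin_free_ext V d (f : 'I_d -> V) v : lin_free f ->
  (forall c, v <> lincomb c f) -> lin_free (famcat f (fun _ : 'I_1 => v)).
Proof.
move=> free_f nv c; rewrite lincomb_cat [lincomb (rsubmx c) _]big_ord1.
set a := rsubmx c 0 0 => cE.
have a0 : a = 0.
  apply: contrapT => /eqP a0; apply: (nv (- a^-1 *: lsubmx c)).
  move/eqP: cE; rewrite addrC addr_eq0 => /eqP cE.
  rewrite -[v](scalerK a0) cE scalerN -scaleNr scaler_sumr.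
  by apply: eq_bigr => i _; rewrite !mxE scalerA.
move: cE; rewrite a0 scale0r addr0 => /free_f lc.
rewrite -[c]hsubmxK lc; suff -> : rsubmx c = 0 by rewrite row_mx0.
by apply/rowP => i; rewrite ord1 [RHS]mxE.
Qed.

Lemma exists_basis V (P : {pred V}) D : subspace (fun v => v \in P) ->
  spannable (fun v => v \in P) D -> exists d (e : 'I_d -> V), is_basis P e.
Proof.
move=> Psub [g Pg].
pose Q d := `[< exists2 f : 'I_d -> V, (forall i, f i \in P) & lin_free f >].
have exQ : exists d, Q d.
  exists 0%N; apply/asboolP; exists (fun=> 0) => [[]//|c _].
  by apply/rowP => -[].
have Qle d : Q d -> (d <= D)%N.
  move=> /asboolP[f Pf free_f]; apply: (lin_free_le (e := g)) free_f _ => i.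
  exact/Pg.
case: (ex_maxnP exQ Qle) => d /asboolP[f Pf free_f] dmax.
exists d, f; split=> // v Pv.
have [c vE] : exists c, v = lincomb c f.
  apply: contrapT => /forallNP nv.
  suff : Q (d + 1)%N by move/dmax; rewrite addn1 ltnn.
  apply/asboolP; exists (famcat f (fun _ : 'I_1 => v)); last exact: lin_free_ext.
  by move=> i; rewrite /famcat; case: fintype.split.
exists c; split=> // c' vE'; apply/eqP; rewrite -subr_eq0; apply/eqP/free_f.
rewrite /lincomb; under eq_bigr do rewrite !mxE scalerBl.
by rewrite sumrB -/(lincomb c f) -vE -vE' subrr.
Qed.

(** [vdim] is a chosen value with default 0, so it says something only once a finite basis is known
    to exist; hence the recurrent [spannable] hypotheses. *)
Lemma vdim_basis V (P : {pred V}) D : subspace (fun v => v \in P) ->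
  spannable (fun v => v \in P) D -> exists e : 'I_(vdim P) -> V,
  [/\ forall i, e i \in P, lin_free e &
      forall v, v \in P -> exists c : 'rV[k]_(vdim P), v = lincomb c e].
Proof.
move=> Psub Pfin.
have /(xgetPex 0%N)[e [Pe unE]] := exists_basis Psub Pfin.
exists e; split=> // [c c0|v /unE[c [-> _]]]; last by exists c.
have [c' [_ unc]] : exists! c : 'rV[k]_(vdim P), 0 = \sum_i c 0 i *: e i.
  by apply: unE; case: Psub.
rewrite -(unc c); last by rewrite -[LHS]c0.
by rewrite (unc 0) // big1 // => i _; rewrite mxE scale0r.
Qed.

Lemma vdim_ge V (P : {pred V}) D d (f : 'I_d -> V) :
    subspace (fun v => v \in P) -> spannable (fun v => v \in P) D ->
  (forall i, f i \in P) -> lin_free f -> (d <= vdim P)%N.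
Proof.
move=> Psub Pfin Pf free_f; have [e [_ _ eP]] := vdim_basis Psub Pfin.
by apply: lin_free_le free_f _ => i; apply: eP.
Qed.

Lemma vdim_spannable V (P : {pred V}) D : subspace (fun v => v \in P) ->
  spannable (fun v => v \in P) D -> spannable (fun v => v \in P) (vdim P).
Proof. by move=> Psub /(vdim_basis Psub)[e [_ _ eP]]; exists e. Qed.

Lemma vdim_eq0 V (P : {pred V}) D : subspace (fun v => v \in P) ->
  spannable (fun v => v \in P) D -> vdim P = 0%N -> forall v, v \in P -> v = 0.
Proof.
move=> Psub Pfin d0 v Pv; have [e eP] := vdim_spannable Psub Pfin.
have [c ->] := eP v Pv; rewrite /lincomb big1 // => i.
by have := ltn_ord i; rewrite {2}d0.
Qed.

Lemma lincomb_map V W (g : V -> W) d (c : 'rV[k]_d) (e : 'I_d -> V) :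
    (forall u v, g (u + v) = g u + g v) -> (forall a v, g (a *: v) = a *: g v) ->
  g (lincomb c e) = lincomb c (g \o e).
Proof.
move=> gD gZ; have g0 : g 0 = 0 by rewrite -(scale0r 0) gZ scale0r.
rewrite /lincomb (big_morph g gD g0); apply: eq_bigr => i _; exact: gZ.
Qed.

Lemma spannable_map V W (g : V -> W) (P : V -> Prop) (Q : W -> Prop) d :
    (forall u v, g (u + v) = g u + g v) -> (forall a v, g (a *: v) = a *: g v) ->
    (forall w, Q w -> exists2 v, P v & g v = w) ->
  spannable P d -> spannable Q d.
Proof.
move=> gD gZ lift [e eP]; exists (g \o e) => w /lift[v /eP[c ->] <-].
by exists c; apply: lincomb_map.
Qed.

(** Half of rank-nullity: a free family in the kernel together with lifts of a basis of the image is
    free. *)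
Lemma vdim_add_le V W (g : V -> W) a (e : 'I_a -> V) (B : {pred V}) (C : {pred W}) D :
    (forall u v, g (u + v) = g u + g v) -> (forall a v, g (a *: v) = a *: g v) ->
    subspace (fun v => v \in B) -> subspace (fun w => w \in C) ->
    spannable (fun v => v \in B) D ->
    lin_free e -> (forall i, e i \in B) -> (forall i, g (e i) = 0) ->
    (forall w, w \in C -> exists2 v, v \in B & g v = w) ->
  (a + vdim C <= vdim B)%N.
Proof.
move=> gD gZ Bsub Csub Bfin free_e eB ge lift.
have Cfin := spannable_map gD gZ lift Bfin.
have [f [fC free_f _]] := vdim_basis Csub Cfin.
have /choice[u uP] i : exists v, v \in B /\ g v = f i.
  by have [v] := lift _ (fC i); exists v.
apply: (vdim_ge (f := famcat e u) Bsub Bfin).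
  by move=> i; rewrite /famcat; case: fintype.split => // j; case: (uP j).
move=> c; rewrite lincomb_cat => c0.
have gc : g (lincomb (lsubmx c) e + lincomb (rsubmx c) u) = lincomb (rsubmx c) f.
  rewrite gD (lincomb_map (lsubmx c) e gD gZ) (lincomb_map (rsubmx c) u gD gZ).
  have -> : lincomb (lsubmx c) (g \o e) = 0.
    by rewrite /lincomb big1 // => i _; rewrite /= ge scaler0.
  by rewrite add0r; apply: eq_bigr => i _; rewrite /= (proj2 (uP i)).
have rc : rsubmx c = 0.
  apply: free_f; rewrite -gc c0; by rewrite -(scale0r 0) gZ scale0r.
rewrite -[c]hsubmxK rc; suff -> : lsubmx c = 0 by rewrite row_mx0.
apply: free_e; rewrite -[LHS]addr0 -[in RHS]c0 rc; congr (_ + _).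
by rewrite /lincomb big1 // => i _; rewrite mxE scale0r.
Qed.

Lemma spannable_sum V (P : nat -> V -> Prop) (d : nat -> nat) L :
    (forall i, spannable (P i) (d i)) ->
  spannable (fun v => exists2 w : nat -> V,
      (forall i, P i (w i)) & v = \sum_(i < L) w i) (\sum_(i < L) d i).
Proof.
move=> Pd; elim: L => [|L [e eP]].
  rewrite big_ord0; exists (fun=> 0) => _ [w _ ->]; exists 0.
  by rewrite /lincomb !big_ord0.
have [f fP] := Pd L; rewrite big_ord_recr /=.
exists (famcat e f) => _ [w Pw ->]; rewrite big_ord_recr /=.
have [|c ->] := eP (\sum_(i < L) w i); first by exists w.
have [c' ->] := fP _ (Pw L).
by exists (row_mx c c'); rewrite lincomb_cat row_mxKl row_mxKr.
Qed.

Lemma spannable_fin V (P : V -> Prop) (T : finType) (f : T -> V) :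
    (forall v, P v -> exists c : T -> k, v = \sum_t c t *: f t) ->
  spannable P #|T|.
Proof.
move=> Pf; exists (fun i => f (enum_val i)) => v /Pf[c ->].
exists (\row_i c (enum_val i)); rewrite /lincomb (reindex_onto enum_val enum_rank).
  by apply: eq_big => i; rewrite ?enum_valK ?eqxx // => _; rewrite mxE.
by move=> t _; rewrite enum_rankK.
Qed.

(** Converts lengths of strict chains into dimensions: a nonzero last coefficient would put the last
    vector into the span of the earlier ones, which lie in the very subspace that it avoids. *)
Lemma chain_free V (U : nat -> V -> Prop) (z : nat -> V) n :
    (forall i, (i < n)%N -> subspace (U i)) ->
    (forall i v, (i.+1 < n)%N -> U i v -> U i.+1 v) ->
    (forall i, (i.+1 < n)%N -> U i.+1 (z i)) ->
    (forall i, (i < n)%N -> ~ U i (z i)) ->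
  lin_free (fun i : 'I_n => z i).
Proof.
elim: n => [|n IH] Usub US Uz nUz c; first by move=> _; apply/rowP => -[].
rewrite /lincomb big_ord_recr /= => c0.
have Uprev m : (m <= n)%N -> forall i, (i < m)%N -> U m (z i).
  elim: m => // m IHm lt_mn i; rewrite ltnS leq_eqVlt => /predU1P[->|im].
    exact: Uz.
  by apply: US => //; apply: IHm => //; apply: ltnW.
have [U0 UD UZ] := Usub n (leqnn _).
have cn : c 0 ord_max = 0.
  apply: contrapT => /eqP cn; apply: (nUz n) => //.
  rewrite -[z n](scalerK cn); apply: (UZ).
  move/eqP: c0; rewrite addrC addr_eq0 => /eqP ->.
  rewrite -scaleN1r; apply: (UZ); elim/big_ind: _ => // i _.
  by apply/UZ/Uprev.
move: c0; rewrite cn scale0r addr0 => c0.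
pose c' := \row_(i < n) c 0 (widen_ord (leqnSn n) i).
have c'0 : c' = 0.
  apply: IH => [i lt_in|i v lt_in|i lt_in|i lt_in|].
  - by apply: Usub; apply: ltnW.
  - by apply: US; apply: ltnW.
  - by apply: Uz; apply: ltnW.
  - by apply: nUz; apply: ltnW.
  by rewrite -[RHS]c0; apply: eq_bigr => i _; rewrite mxE.
apply/rowP => i; rewrite [RHS]mxE.
have [im|->] := unliftP ord_max i; last by [].
move=> ->; have /rowP/(_ im) := c'0; rewrite !mxE => <-.
by congr (c 0 _); apply: val_inj; rewrite /= /bump leqNgt ltn_ord.
Qed.

End LinearAlgebra.

(** * Gradings and quotients *)

Section GradingProjections.
Variables (I : eqType) (V : zmodType) (G : I -> {pred V}).
Hypothesis GV : is_grading G.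

Let G0 i : 0 \in G i. Proof. by case: GV => /(_ i)[]. Qed.

Let GB i a b : a \in G i -> b \in G i -> a - b \in G i.
Proof. by case: GV => /(_ i)[_ +] _ _; apply. Qed.

(** Decompositions as families on all of I with finite support, so that two of them can be
    subtracted and compared index by index. *)
Let dec z (c : I -> V) := (forall i, c i \in G i) /\ exists s : seq I,
  [/\ uniq s, forall i, i \notin s -> c i = 0 & z = \sum_(i <- s) c i].

Let sum_widen (s t : seq I) (c : I -> V) : uniq s -> uniq t -> {subset s <= t} ->
  (forall i, i \notin s -> c i = 0) -> \sum_(i <- s) c i = \sum_(i <- t) c i.
Proof.
move=> us ut st c0; rewrite [RHS](bigID (mem s)) /= [X in _ + X]big1; last first.
  by move=> i; apply: c0.
rewrite addr0 -[RHS]big_filter; apply: perm_big; apply: uniq_perm => //.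
  exact: filter_uniq.
by move=> i; rewrite mem_filter andb_idr //; apply: st.
Qed.

Let decB z z' c c' : dec z c -> dec z' c' -> dec (z - z') (fun i => c i - c' i).
Proof.
move=> [cG [s [us cs ->]]] [cG' [s' [us' cs' ->]]]; split=> [i|]; first exact: GB.
exists (undup (s ++ s')); split=> [|i|]; first exact: undup_uniq.
  by rewrite mem_undup mem_cat negb_or => /andP[/cs-> /cs'->]; rewrite subr0.
rewrite sumrB; congr (_ - _); apply: sum_widen => //;
  by [apply: undup_uniq | move=> i si; rewrite mem_undup mem_cat si ?orbT].
Qed.

Let dec0 c : dec 0 c -> forall i, c i = 0.
Proof.
move=> [cG [s [us cs /esym s0]]] i; have [si|/cs//] := boolP (i \in s).
by case: GV => _ _ /(_ s c us cG s0 i si).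
Qed.

Let dec_uniq z c c' : dec z c -> dec z c' -> forall i, c i = c' i.
Proof.
move=> zc zc' i; apply/eqP; rewrite -subr_eq0; apply/eqP.
by apply: (dec0 (c := fun i => c i - c' i)); rewrite -(subrr z); apply: decB.
Qed.

Let dec_homog i z : z \in G i -> dec z (fun j => if j == i then z else 0).
Proof.
move=> zG; split=> [j|]; first by case: eqP => // ->.
exists [:: i]; split=> // [j|]; first by rewrite inE => /negPf->.
by rewrite big_seq1 eqxx.
Qed.

Let dec_exists z : exists c, dec z c.
Proof.
have [_ /(_ z)[s [c [cG ->]]] _] := GV.
have dec_0 : dec 0 (fun=> 0) by split=> //; exists [::]; rewrite big_nil.
(* The sequence supplied by [is_grading] may repeat indices, so the terms are added one at a
   time. *)
elim: s => [|i s [d sd]]; first by exists (fun=> 0); rewrite big_nil.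
rewrite big_cons -[\sum_(j <- s) _]opprK -[- \sum_(j <- s) _]sub0r.
by eexists; apply: decB (decB dec_0 sd); apply: dec_homog.
Qed.

Lemma grading_proj : exists pr : I -> V -> V,
  [/\ forall i z, pr i z \in G i, forall i, {morph pr i : a b / a - b},
      forall i z, z \in G i -> pr i z = z,
      forall i j z, i <> j -> z \in G i -> pr j z = 0
    & forall z, exists2 s, uniq s & z = \sum_(i <- s) pr i z].
Proof.
have [c cP] := choice dec_exists; exists (fun i z => c z i).
split=> [i z|i a b|i z zG|i j z ij zG|z].
- by case: (cP z).
- exact: (dec_uniq (cP _) (decB (cP a) (cP b))).
- by rewrite (dec_uniq (cP z) (dec_homog zG)) eqxx.
- by rewrite (dec_uniq (cP z) (dec_homog zG)); case: eqP => // ji; case: ij.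
by case: (cP z) => _ [s [us _ zs]]; exists s.
Qed.

End GradingProjections.

(** * Quotients by submodules, plain and graded *)

Section QuotientModule.
Variables (R : pzRingType) (V : lmodType R) (K : V -> Prop).
Hypothesis KP : submodule K.

Definition submod_pred : {pred V} := fun z => `[<K z>].

Fact submod_pred_zmod : zmod_closed submod_pred.
Proof.
split=> [|a b /asboolP Ka /asboolP Kb]; apply/asboolP; first exact: submod0 KP.
exact: submodB KP _ _ Ka Kb.
Qed.

HB.instance Definition _ := GRing.isZmodClosed.Build V submod_pred submod_pred_zmod.

Definition quotmod : Type := Quotient.quot submod_pred.

HB.instance Definition _ := GRing.Zmodule.on quotmod.

Local Notation pi := (\pi_(Quotient.quot submod_pred))%qT.

Definition quotmod_scale (a : R) (y : quotmod) : quotmod := pi (a *: repr y).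

Lemma pi_eq0 z : pi z = 0 <-> K z.
Proof.
rewrite -(raddf0 pi); split=> [/eqP|Kz].
  by rewrite -Quotient.idealrBE subr0 => /asboolP.
by apply/eqP; rewrite -Quotient.idealrBE subr0; apply/asboolP.
Qed.

Lemma pi_scale a z : quotmod_scale a (pi z) = pi (a *: z).
Proof.
apply/eqP; rewrite -subr_eq0 -raddfB -scalerBr; apply/eqP/pi_eq0; apply: (submodZ KP).
by apply/pi_eq0; rewrite raddfB /= reprK subrr.
Qed.

Lemma pi_surj (y : quotmod) : exists z, pi z = y.
Proof. by exists (repr y); apply: reprK. Qed.

Fact quotmod_scaleA a b y :
  quotmod_scale a (quotmod_scale b y) = quotmod_scale (a * b) y.
Proof.
by have [z <-] := pi_surj y; rewrite (pi_scale b) (pi_scale a) pi_scale scalerA.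
Qed.

Fact quotmod_scale1 : left_id 1 quotmod_scale.
Proof. by move=> y; have [z <-] := pi_surj y; rewrite pi_scale scale1r. Qed.

Fact quotmod_scaleDr : right_distributive quotmod_scale +%R.
Proof.
move=> a y y'; have [z <-] := pi_surj y; have [z' <-] := pi_surj y'.
by rewrite -[_ + _ in LHS]raddfD !pi_scale scalerDr raddfD.
Qed.

Fact quotmod_scaleDl y : {morph quotmod_scale^~ y : a b / a + b}.
Proof.
by move=> a b; have [z <-] := pi_surj y; rewrite !pi_scale scalerDl raddfD.
Qed.

HB.instance Definition _ := GRing.Zmodule_isLmodule.Build R quotmod
  quotmod_scaleA quotmod_scale1 quotmod_scaleDr quotmod_scaleDl.

Definition quotmod_pi (z : V) : quotmod := pi z.

Fact quotmod_pi_linear : linear quotmod_pi.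
Proof.
by move=> a y z; rewrite -[RHS]/(quotmod_scale a (pi y) + pi z) pi_scale -raddfD.
Qed.

HB.instance Definition _ :=
  GRing.isLinear.Build R V quotmod _ quotmod_pi quotmod_pi_linear.

Lemma quotient_module : exists (Q : lmodType R) (f : {linear V -> Q}),
  (forall y, exists z, f z = y) /\ forall z, f z = 0 <-> K z.
Proof.
exists quotmod, quotmod_pi; split=> [y|z]; last exact: pi_eq0.
by exists (repr y); apply: reprK.
Qed.

End QuotientModule.

Section GradedQuotient.
Variables (k : fieldType) (R : homogAlg k) (M : gmod R) (K : M -> Prop).
Hypothesis KP : submodule K.
Hypothesis Kgr : forall (s : seq int) (c : int -> M), uniq s ->
  (forall i, c i \in gcomp M i) -> K (\sum_(i <- s) c i) -> {in s, forall i, K (c i)}.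

(** Degree j of N is the image of degree j of M; homogeneity of K keeps the sum direct. The
    equivalence in the last clause lets homogeneous elements be lifted within their degree. *)
Lemma graded_quotient : exists (N : gmod R) (f : {linear M -> N}),
  [/\ forall y, exists z, f z = y, forall z, f z = 0 <-> K z &
      forall j y, y \in gcomp N j <-> exists2 z, z \in gcomp M j & f z = y].
Proof.
have [Q [f [f_surj fK]]] := quotient_module KP.
pose G j : {pred Q} := fun y => `[<exists2 z, z \in gcomp M j & f z = y>].
have GP j y : y \in G j <-> exists2 z, z \in gcomp M j & f z = y.
  by split=> /asboolP.
have [Gzmod Gdec Gfree] := gcomp_grading M.
have Ggrading : is_grading G.
  split=> [j|y|s c us cG c0].
  - have [M0 MB] := Gzmod j; split; first by apply/GP; exists 0; rewrite ?raddf0.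
    move=> _ _ /GP[z zG <-] /GP[z' zG' <-]; apply/GP; exists (z - z').
      exact: MB.
    exact: raddfB.
  - have [z <-] := f_surj y; have [s [c [cG ->]]] := Gdec z.
    exists s, (fun i => f (c i)); split; last exact: raddf_sum.
    by move=> i; apply/GP; exists (c i).
  have /choice[d dP] i : exists z, z \in gcomp M i /\ f z = c i.
    by have /GP[z] := cG i; exists z.
  move=> i si; rewrite -(proj2 (dP i)); apply/fK; apply: (Kgr us) si.
    by move=> l; case: (dP l).
  by apply/fK; rewrite raddf_sum -[RHS]c0; apply: eq_bigr => l _; case: (dP l).
have Gscale (i : nat) (j : int) (a : R) (y : Q) :
    a \in hcomp R i -> y \in G j -> a *: y \in G (i%:Z + j).
  move=> aR /GP[z zG <-]; apply/GP; exists (a *: z); last exact: linearZ.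
  exact: gcomp_scale.
have Gfg : exists n (g : 'I_n -> Q), forall y,
    exists c : 'I_n -> R, y = \sum_i c i *: g i.
  have [n [g gP]] := gmod_fg M; exists n, (f \o g) => y.
  have [z <-] := f_surj y; have [c ->] := gP z; exists c.
  by rewrite raddf_sum; apply: eq_bigr => i _; apply: linearZ.
by exists (GMod Ggrading Gscale Gfg), f.
Qed.

End GradedQuotient.

Lemma seq_submodE (k : fieldType) (R : homogAlg k) (M : gmod R) (a : R) (z : M) :
  seq_submod [:: a] z <-> exists y, z = a *: y.
Proof.
split=> [[c]|[y ->]]; first by rewrite big_ord1 /=; exists (c 0%N).
by exists (fun=> y); rewrite big_ord1.
Qed.

Lemma degree1_irrelevant (k : fieldType) (R : homogAlg k) (x : R) :
  x \in hcomp R 1%N -> irrelevant x.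
Proof.
move=> x1; exists 1%N, (fun j => if j == 0%N then x else 0).
rewrite big_ord1; split=> // j.
by case: eqP => [->|_] //; case: (hcomp_grading R) => /(_ j.+1)[].
Qed.

(** * Homogeneous components *)

Section Components.
Variables (k : fieldType) (R : homogAlg k) (M : gmod R).

Definition gpr : int -> M -> M := projT1 (cid (grading_proj (gcomp_grading M))).

Let gprP := projT2 (cid (grading_proj (gcomp_grading M))).

Lemma gpr_in j z : gpr j z \in gcomp M j.
Proof. by case: gprP => + _ _ _ _; apply. Qed.

Lemma gprB j : {morph gpr j : a b / a - b}.
Proof. by case: gprP => _ + _ _ _; apply. Qed.

Lemma gpr_id j z : z \in gcomp M j -> gpr j z = z.
Proof. by case: gprP => _ _ + _ _; apply. Qed.

Lemma gpr_out i j z : i <> j -> z \in gcomp M i -> gpr j z = 0.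
Proof. by case: gprP => _ _ _ + _; apply. Qed.

Lemma gpr_sum z : exists2 s, uniq s & z = \sum_(i <- s) gpr i z.
Proof. by case: gprP. Qed.

Lemma gpr0 j : gpr j 0 = 0. Proof. exact: morphB0 (gprB j). Qed.

Lemma gprD j : {morph gpr j : a b / a + b}.
Proof. exact: morphBD (gprB j). Qed.

Lemma gpr_eq0 z : (forall j, gpr j z = 0) -> z = 0.
Proof. by move=> z0; have [s _ ->] := gpr_sum z; apply: big1 => i _; apply: z0. Qed.

Lemma gpr_big j (s : seq int) (c : int -> M) : uniq s ->
    (forall i, c i \in gcomp M i) ->
  gpr j (\sum_(i <- s) c i) = if j \in s then c j else 0.
Proof.
move=> us cG; rewrite (big_morph (gpr j) (gprD j) (gpr0 j)).
case: ifP => js.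
  rewrite (bigD1_seq j) //= gpr_id // big1 ?addr0 // => i /eqP ij.
  exact: gpr_out (cG i).
rewrite big_seq big1 // => i si; apply: gpr_out (cG i) => ij.
by rewrite -ij si in js.
Qed.

Lemma gcomp0 j : 0 \in gcomp M j.
Proof. by case: (gcomp_grading M) => /(_ j)[]. Qed.

Lemma gcompB j a b : a \in gcomp M j -> b \in gcomp M j -> a - b \in gcomp M j.
Proof. by case: (gcomp_grading M) => /(_ j)[_ +] _ _; apply. Qed.

Lemma gcompN j a : a \in gcomp M j -> - a \in gcomp M j.
Proof. by move=> aM; rewrite -sub0r gcompB ?gcomp0. Qed.

Lemma gcompD j a b : a \in gcomp M j -> b \in gcomp M j -> a + b \in gcomp M j.
Proof. by move=> aM bM; rewrite -[b]opprK gcompB ?gcompN. Qed.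

Lemma gpr_scale (i : nat) j a z : a \in hcomp R i ->
  gpr (i%:Z + j) (a *: z) = a *: gpr j z.
Proof.
move=> aR; have [s us zE] := gpr_sum z.
have inj_i : injective (fun l : int => i%:Z + l) by apply: addrI.
pose c (l : int) : M := a *: gpr (l - i%:Z) z.
have cG l : c l \in gcomp M l.
  by rewrite /c -[in gcomp M _](subrKC i%:Z l) gcomp_scale ?gpr_in.
have -> : a *: z = \sum_(l <- map (fun l : int => i%:Z + l) s) c l.
  rewrite {1}zE scaler_sumr big_map; apply: eq_bigr => l _.
  by rewrite /c addrAC subrr add0r.
rewrite gpr_big ?map_inj_uniq // mem_map // /c addrAC subrr add0r.
by case: ifP => // js; rewrite zE gpr_big ?js ?scaler0 // => l; apply: gpr_in.
Qed.

Lemma gpr_scale1 j a z : a \in hcomp R 1%N -> gpr j (a *: z) = a *: gpr (j - 1) z.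
Proof. by move=> aR; rewrite -(gpr_scale (j - 1) z aR) subrKC. Qed.

Lemma scalek_in j (c : k) z : z \in gcomp M j -> (c%:A : R) *: z \in gcomp M j.
Proof.
move=> zM; rewrite -[j]add0r; apply: (@gcomp_scale _ _ M 0%N) => //.
by apply/hcomp0; exists c.
Qed.

Lemma scale1_in j a z :
  a \in hcomp R 1%N -> z \in gcomp M j -> a *: z \in gcomp M (j + 1).
Proof. by move=> aR zM; rewrite addrC; apply: (@gcomp_scale _ _ M 1%N). Qed.

Lemma gcomp_subspace j : subspace (fun z : kmod M => z \in gcomp M j).
Proof.
split=> [|u v|a v]; [exact: gcomp0 | exact: gcompD | exact: scalek_in].
Qed.

End Components.

(** * Generators of the irrelevant ideal and torsion *)

Section Generators.
Variables (k : fieldType) (R : homogAlg k) (n : nat) (e : 'I_n -> R).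
Hypothesis e1 : forall a, e a \in hcomp R 1%N.
Hypothesis e_gen : forall x, exists p, aeval e p = x.

Lemma aevalC c : aeval e c%:MP = c%:A.
Proof. exact: mmapC. Qed.

Lemma aevalX i : aeval e 'X_i = e i.
Proof. by rewrite /aeval mmapX mmap1U. Qed.

Lemma aevalM p q : aeval e (p * q) = aeval e p * aeval e q.
Proof. exact: rmorphM. Qed.

Lemma aevalD p q : aeval e (p + q) = aeval e p + aeval e q.
Proof. exact: rmorphD. Qed.

Lemma aeval_homog m : aeval e 'X_[m] \in hcomp R (mdeg m).
Proof.
rewrite /aeval mmapX /mmap1 mdegE.
pose P (x : R) (d : nat) := x \in hcomp R d.
have R1 : (1 : R) \in hcomp R 0%N by apply/hcomp0; exists 1; rewrite scale1r.
apply: (big_ind2 P) => // [x d y d' |i _]; first exact: hcomp_mul.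
elim: (m i) => // d IH; rewrite exprS -add1n; exact: hcomp_mul.
Qed.

Lemma alg_decomp x : exists (a : k) (r : 'I_n -> R), x = a%:A + \sum_i r i * e i.
Proof.
have [p <-] := e_gen x; elim/mpolyind: p => [|c m p _ _ [a [r IH]]].
  exists 0, (fun=> 0); rewrite scale0r add0r big1 => [|i _]; last by rewrite mul0r.
  by rewrite /aeval mmap0.
rewrite aevalD {}IH; have [m0|] := eqVneq (mdeg m) 0%N.
  exists (c + a), r; move/eqP: m0; rewrite mdeg_eq0 => /eqP->.
  by rewrite mpolyX0 alg_mpolyC aevalC scalerDl addrA.
move=> m0; have [i mi] : exists i, m i != 0%N.
  apply: contrapT => nex; case/eqP: m0; rewrite mdegE; apply: big1 => i _.
  by apply: contrapT => /eqP mi; apply: nex; exists i.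
exists a, (fun j => r j + if j == i then aeval e (c *: 'X_[m - U_(i)]) else 0).
under [in RHS]eq_bigr do rewrite mulrDl; rewrite big_split /=.
rewrite [X in _ = _ + (_ + X)](bigD1 i) //= eqxx.
rewrite [X in _ = _ + (_ + (_ + X))]big1; last first.
  by move=> j /negPf->; rewrite mul0r.
rewrite addr0 -(aevalX i) -aevalM -scalerAl -mpolyXD submK ?lep1mP //.
by rewrite addrC addrA.
Qed.

(** The constant term given by [alg_decomp] is the degree 0 component of x, which vanishes. *)
Lemma irrelevant_gen x : irrelevant x -> exists r : 'I_n -> R, x = \sum_i r i * e i.
Proof.
have [pr [pr_in prB pr_id pr_out pr_sum]] := grading_proj (hcomp_grading R).
have prD i := morphBD (prB i); have pr0 i := morphB0 (prB i).
move=> [m [c [cR xE]]]; have [a [r xE']] := alg_decomp x.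
exists r; rewrite xE'; suff -> : a%:A = 0 :> R by rewrite add0r.
have aR : a%:A \in hcomp R 0%N by apply/hcomp0; exists a.
rewrite -(pr_id _ _ aR) -[a%:A](addrK (\sum_i r i * e i)) -xE' prB xE.
rewrite !(big_morph (pr 0%N) (prD 0%N) (pr0 0%N)) !big1 ?subrr // => i _.
  have [s _ ->] := pr_sum (r i); rewrite mulr_suml.
  rewrite (big_morph (pr 0%N) (prD 0%N) (pr0 0%N)) big1 // => j _.
  apply: (pr_out (j + 1)%N); first by rewrite addn1.
  exact: hcomp_mul.
by apply: (pr_out i.+1) => //.
Qed.

Section Torsion.
Variable M : gmod R.

(** Annihilation by the t-th power of the irrelevant ideal, tested on finitely many products of
    generators; the finiteness gives the common exponent in [Gamma_quotient]. *)
Definition killed t (z : M) :=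
  forall s : seq 'I_n, size s = t -> (\prod_(i <- s) e i) *: z = 0.

Lemma killed_submodule t : submodule (killed t).
Proof.
split=> [s _|a b Ka Kb s st|r a Ka s st]; first by rewrite scaler0.
  by rewrite scalerBr Ka // Kb // subrr.
by rewrite scalerA mulrC -scalerA Ka // scaler0.
Qed.

Lemma killedS t z : killed t.+1 z <-> forall i, killed t (e i *: z).
Proof.
split=> [Kz i s st|Kz [//|i s] [st]].
  by rewrite scalerA mulrC -(Kz (i :: s)) ?big_cons //= st.
by rewrite big_cons mulrC -scalerA Kz.
Qed.

Lemma killed_mono t t' z : (t <= t')%N -> killed t z -> killed t' z.
Proof.
move=> le_t Kz; apply: (chain_mono (U := killed)) le_t Kz => {}t {}z Kz.
apply/killedS => i; exact: (submodZ (killed_submodule t)).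
Qed.

Lemma killed_prod t t' z : (forall s : seq 'I_n, size s = t ->
  killed t' ((\prod_(i <- s) e i) *: z)) -> killed (t + t') z.
Proof.
move=> Kz s st; rewrite -(cat_take_drop t s) big_cat /= mulrC -scalerA Kz //.
  by rewrite size_takel // st leq_addr.
by rewrite size_drop st addKn.
Qed.

Lemma GammaP (z : M) : Gamma z <-> exists t, killed t z.
Proof.
split=> [[t0 Kz]|[t0 Kz]].
  exists t0 => s st; rewrite -(big_map e xpredT id); apply: (Kz t0) => //.
    by rewrite size_map.
  by move=> _ /mapP[i _ ->]; apply: degree1_irrelevant.
exists t0 => t le_t s; have {le_t}Kz := killed_mono le_t Kz.
elim: s t z Kz => [|a s IH] t z Kz st sI.
  by move: Kz; rewrite -st => /(_ [::] erefl); rewrite !big_nil.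
case: t Kz st => // t Kz [st]; rewrite big_cons mulrC -scalerA (IH t) //; last first.
  by move=> b bs; apply: sI; rewrite inE bs orbT.
have [|r ->] := @irrelevant_gen a; first by apply: sI; rewrite inE eqxx.
rewrite scaler_suml; apply: (submod_sum (killed_submodule t)) => i.
rewrite -scalerA; apply: (submodZ (killed_submodule t)).
exact: (proj1 (killedS t z) Kz).
Qed.

Lemma Gamma_submodule : submodule (@Gamma k R M).
Proof.
split=> [|a b /GammaP[t Ka] /GammaP[t' Kb]|r a /GammaP[t Ka]]; apply/GammaP.
- by exists 0%N; apply: submod0 (killed_submodule 0).
- exists (maxn t t'); apply: (submodB (killed_submodule _)).
    by apply: killed_mono Ka; apply: leq_maxl.
  by apply: killed_mono Kb; apply: leq_maxr.
by exists t; apply: (submodZ (killed_submodule t)).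
Qed.

Lemma prod_gen_in (s : seq 'I_n) : \prod_(i <- s) e i \in hcomp R (size s).
Proof.
elim: s => [|i s IH]; last by rewrite big_cons /= -add1n; apply: hcomp_mul.
by rewrite big_nil; apply/hcomp0; exists 1; rewrite scale1r.
Qed.

Lemma Gamma_gpr (z : M) j : Gamma z -> Gamma (gpr j z).
Proof.
move=> /GammaP[t Kz]; apply/GammaP; exists t => s st.
by rewrite -(gpr_scale _ _ (prod_gen_in s)) Kz // gpr0.
Qed.

Lemma Gamma_homog (s : seq int) (c : int -> M) : uniq s ->
    (forall i, c i \in gcomp M i) -> Gamma (\sum_(i <- s) c i) ->
  {in s, forall i, Gamma (c i)}.
Proof.
by move=> us cG /Gamma_gpr Kz i si; have := Kz i; rewrite gpr_big // si.
Qed.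

Lemma acc_gmod : acc M.
Proof.
have [q [g gP]] := gmod_fg M.
have := @acc_mpoly k n; apply: (@acc_fg _ _ (mmap (GRing.in_alg R) e) _ _ g) => //.
Qed.

End Torsion.

End Generators.

(** * Existence of a regular linear form *)

Lemma infinite_inj (T : choiceType) :
  infinite_set [set: T]%classic -> exists f : nat -> T, injective f.
Proof.
move=> Tinf; have [t _] := infinite_setN0 Tinf.
pose Tp : pointedType := HB.pack (Choice.sort T) (isPointed.Build _ t).
have /infiniteP/(@pcard_leTP _ Tp)/injPex[f f_inj] := Tinf.
by exists f => i j; apply: f_inj; rewrite inE.
Qed.

Section RegularLinearForm.
Variables (k : fieldType) (R : homogAlg k) (n : nat) (e : 'I_n -> R).
Hypothesis e1 : forall a, e a \in hcomp R 1%N.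
Hypothesis e_gen : forall x, exists p, aeval e p = x.
Variable N : gmod R.

Definition moment_form (t : k) : R := \sum_(j < n) (t ^+ j)%:A * e j.

Lemma moment_form1 t : moment_form t \in hcomp R 1%N.
Proof.
have [R0 RB] : zmod_closed (hcomp R 1%N) by case: (hcomp_grading R).
rewrite /moment_form; elim/big_ind: _ => [//|a b aR bR|j _].
  by rewrite -[b]opprK -[- b]sub0r !RB.
apply: (@hcomp_mul _ R 0%N 1%N) => //; apply/hcomp0; by eexists.
Qed.

(** The Vandermonde matrix of distinct parameters is invertible, so each [e i] is a combination of
    the n forms. *)
Lemma moment_form_socle (s : seq k) (z : N) : uniq s -> size s = n ->
  (forall u, u \in s -> moment_form u *: z = 0) -> forall i, e i *: z = 0.
Proof.
move=> us sn sz l.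
pose A := \matrix_(i < n, j < n) s`_i ^+ j.
have AU : A \in unitmx.
  have -> : A = (Vandermonde n (\row_(i < n) s`_i))^T.
    by apply/matrixP => i j; rewrite !mxE.
  rewrite unitmx_tr unitmxE det_Vandermonde unitfE.
  apply/prodf_neq0 => i _; apply/prodf_neq0 => j ij; rewrite !mxE subr_eq0.
  by rewrite nth_uniq ?sn // eq_sym; apply: contraTneq ij => ->; rewrite ltnn.
have Az i : \sum_j (A i j)%:A *: (e j *: z) = 0.
  rewrite -[RHS](sz s`_i) ?mem_nth ?sn // scaler_suml; apply: eq_bigr => j _.
  by rewrite mxE scalerA.
have mulVA j : \sum_i invmx A l i * A i j = (l == j)%:R.
  by have /matrixP/(_ l j) := mulVmx AU; rewrite mxE => ->; rewrite mxE.
have algM (a b : k) : a%:A * b%:A = (a * b)%:A :> R.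
  by rewrite -scalerAl mul1r scalerA.
have <- : \sum_i (invmx A l i)%:A *: (\sum_j (A i j)%:A *: (e j *: z)) = e l *: z.
  under eq_bigr do rewrite scaler_sumr.
  rewrite exchange_big /=.
  transitivity (\sum_j ((l == j)%:R%:A : R) *: (e j *: z)).
    apply: eq_bigr => j _; rewrite -mulVA !scaler_suml; apply: eq_bigr => i _.
    by rewrite -algM -scalerA.
  rewrite (bigD1 l) //= eqxx !scale1r big1 ?addr0 // => j /negPf jl.
  by rewrite eq_sym jl !scale0r.
by apply: big1 => i _; rewrite Az scaler0.
Qed.

(** Take the factor at which the partial products applied to z first vanish; r is the product before
    it. *)
Lemma zero_divisor_factor (J : nat) (a : nat -> R) (z : N) : z <> 0 ->
    (\prod_(i < J) a i) *: z = 0 ->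
  exists2 i, (i < J)%N & exists r, r *: z <> 0 /\ a i *: (r *: z) = 0.
Proof.
elim: J => [|J IH] z0; first by rewrite big_ord0 scale1r.
rewrite big_ord_recr /= mulrC -scalerA => az.
have [pz|pz] := pselect ((\prod_(i < J) a i) *: z = 0).
  by have [i iJ [r rz]] := IH z0 pz; exists i; [apply: ltnW | exists r].
by exists J => //; exists (\prod_(i < J) a i).
Qed.

(* If all the forms on the moment curve were zero divisors, the ascending chain
   condition on sums of their annihilators would make infinitely many of these
   annihilators meet a common one; iterating, n of them would meet, whereas n
   forms on the curve span the same space as e. *)
Lemma regular_linear_form : infinite_set [set: k]%classic ->
    (forall z : N, (forall i, e i *: z = 0) -> z = 0) ->
  exists2 a, a \in hcomp R 1%N & regular_elt N a.
Proof.
move=> /infinite_inj[tau tau_inj] socle0.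
apply: contrapT => noreg.
have zd t : exists z : N, z <> 0 /\ moment_form t *: z = 0.
  apply: contrapT => /forallNP nz; apply: noreg.
  exists (moment_form t) => [|z tz]; first exact: moment_form1.
  by apply: contrapT => z0; apply: (nz z).
(* s lists the m parameters already shared; [sig] is an infinite supply of others, each having with
   s a common nonzero annihilated element. *)
suff main m : exists (s : seq k) (sig : nat -> k),
    [/\ uniq s, size s = m, injective sig, forall i, sig i \notin s &
        forall i, exists z : N, [/\ z <> 0, forall u, u \in s -> moment_form u *: z = 0
          & moment_form (sig i) *: z = 0]].
  have [s [sig [us sn _ _ /(_ 0%N)[z [z0 sz _]]]]] := main n.
  exact/z0/socle0/(moment_form_socle us sn).
elim: m => [|m [s [sig [us sm sig_inj sigs sigz]]]].
  exists [::], tau; split=> // i.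
  by have [z [z0 tz]] := zd (tau i); exists z.
pose Z j (z : N) := (forall u, u \in s -> moment_form u *: z = 0)
  /\ moment_form (sig j) *: z = 0.
have Zsub j : submodule (Z j).
  split=> [|a b [sa ja] [sb jb]|r a [sa ja]].
  - by split=> [u _|]; rewrite scaler0.
  - by split=> [u us'|]; rewrite scalerBr; [rewrite sa // sb //|rewrite ja jb];
      rewrite subrr.
  by split=> [u us'|]; rewrite scalerA mulrC -scalerA; [rewrite sa //|rewrite ja];
    rewrite scaler0.
pose U i z := exists w : nat -> N, (forall j, Z j (w j)) /\ z = \sum_(j < i) w j.
have [||J JP] := acc_gmod e_gen (M := N) (U := U).
- move=> i; split=> [|_ _ [w [Zw ->]] [w' [Zw' ->]]|r _ [w [Zw ->]]].
  + exists (fun=> 0); split=> [j|]; last by rewrite big1.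
    exact: submod0 (Zsub j).
  + exists (fun j => w j - w' j); split=> [j|]; last by rewrite sumrB.
    exact: submodB (Zsub j) _ _ (Zw j) (Zw' j).
  exists (fun j => r *: w j); split=> [j|]; last by rewrite scaler_sumr.
  exact: submodZ (Zsub j) _ _ (Zw j).
- move=> i _ [w [Zw ->]]; exists (fun j => if j == i then 0 else w j).
  split=> [j|]; first by case: eqP => // _; apply: submod0 (Zsub j).
  rewrite big_ord_recr /= eqxx addr0; apply: eq_bigr => j _.
  by rewrite ltn_eqF.
(* By stationarity an element of [Z (J + j)] is a sum of elements of Z 0, ..., Z (J - 1), so the
   product of the first J forms kills it. Some factor then kills a nonzero multiple, which stays in
   [Z (J + j)]. *)
have /choice[g gP] j : exists i, (i < J)%N /\ exists y : N,
    [/\ y <> 0, Z (J + j)%N y & moment_form (sig i) *: y = 0].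
  have [z [z0 sz jz]] := sigz (J + j)%N.
  have Zz : Z (J + j)%N z by [].
  have [|w [Zw zE]] := JP (J + j).+1 z (leqW (leq_addr _ _)).
    exists (fun i => if i == (J + j)%N then z else 0); split=> [i|].
      by case: eqP => [->//|_]; apply: submod0 (Zsub i).
    rewrite big_ord_recr /= eqxx big1 ?add0r // => i _.
    by rewrite ltn_eqF.
  have [|i iJ [r [rz ri]]] := @zero_divisor_factor J (fun i => moment_form (sig i)) z z0.
    rewrite zE scaler_sumr big1 // => i _.
    by rewrite (bigD1 i) //= mulrC -scalerA (proj2 (Zw i)) scaler0.
  exists i; split=> //; exists (r *: z); split=> //; exact: submodZ (Zsub _) _ _ Zz.
(* One i < J serves infinitely many j: its parameter joins s. The shift by J keeps the remaining
   parameters distinct from it. *)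
have [t t_mono gt] := constant_subseq (fun j => proj1 (gP j)).
exists (sig (g (t 0%N)) :: s), (fun j => sig (J + t j)%N); split=> /=.
- by rewrite sigs us.
- by rewrite sm.
- move=> i j /= /sig_inj/eqP; rewrite eqn_add2l => /eqP tij.
  by case: (ltngtP i j) => // /t_mono; rewrite tij ltnn.
- move=> i; rewrite inE negb_or sigs andbT; apply/eqP => /sig_inj E.
  by have := proj1 (gP (t 0%N)); rewrite -E ltnNge leq_addr.
move=> i; have [_ [y [y0 [sy iy] gy]]] := gP (t i); exists y; split=> // u.
by rewrite inE => /predU1P[->|/sy//]; rewrite -(gt i).
Qed.

End RegularLinearForm.

(** * Free resolutions and the Koszul complex *)

(** The Koszul recursion indexes its operators by natural numbers; those from n on are set to
    zero. *)
Definition ext_ord (A : zmodType) n (e : 'I_n -> A) (i : nat) : A :=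
  if insub i is Some j then e j else 0.

(** * Divided differences and graded free modules *)

Section DividedDifference.
Variables (k : fieldType) (n : nat).
Local Notation S := {mpoly k[n]}.

Lemma mcoeffXUM (j : 'I_n) (p : S) m :
  ('X_j * p)@_m = if m j == 0%N then 0 else p@_(m - U_(j)).
Proof.
rewrite mulrC; case: ifP => [/eqP mj|/negbT mj]; last first.
  by rewrite -{1}[m](@submK _ U_(j)) ?lep1mP // addmC mcoeffMX.
apply: memN_msupp_eq0; rewrite (perm_mem (msuppMX p U_(j))).
by apply/mapP => -[m' _ /mnmP/(_ j)]; rewrite mj mnmDE mnm1E eqxx.
Qed.

(* (p - p|_{X_i = 0}) / X_i *)
Definition divdiff (i : 'I_n) (p : S) : S :=
  \sum_(m <- msupp p | m i != 0%N) p@_m *: 'X_[m - U_(i)].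

Lemma mcoeff_divdiff i p m : (divdiff i p)@_m = p@_(m + U_(i)).
Proof.
rewrite /divdiff (raddf_sum (mcoeff m)) /=.
have term (m' : 'X_{1..n}) : m' i != 0%N -> (p@_m' *: 'X_[m' - U_(i)])@_m =
    if m' == (m + U_(i))%MM then p@_m' else 0.
  move=> mi; rewrite mcoeffZ mcoeffX -(eqm_add2r U_(i)) submK ?lep1mP //.
  by case: eqP; rewrite (mulr1, mulr0).
rewrite (eq_bigr _ (fun m' => @term m')) big_mkcond /=.
have mUi : (m + U_(i))%MM i != 0%N by rewrite mnmDE mnm1E eqxx addn1.
have [ms|ms] := boolP ((m + U_(i))%MM \in msupp p).
  rewrite (bigD1_seq (m + U_(i))%MM) ?msupp_uniq //= mUi eqxx.
  by rewrite big1 ?addr0 // => m' /negPf->; rewrite if_same.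
rewrite (memN_msupp_eq0 ms) big1_seq // => m' /andP[_ ms'].
by case: (m' =P _) => [m'E|_]; [rewrite -m'E ms' in ms | rewrite if_same].
Qed.

End DividedDifference.

Section FreeModules.
Variables (k : fieldType) (n q : nat) (deg : 'I_q -> int).
Local Notation S := {mpoly k[n]}.
Implicit Types (v : 'rV[S]_q) (P : int -> Prop).

(** A predicate on degrees instead of one degree, so that it also describes the remainder in
    [homog_split], which has no part in degree j. *)
Definition degrees_in P v :=
  forall a m, (v 0 a)@_m != 0 -> P ((mdeg m)%:Z + deg a).

Definition is_homog (j : int) v := degrees_in (fun l => l = j) v.

Lemma degrees_in0 P : degrees_in P 0.
Proof. by move=> a m; rewrite mxE mcoeff0 eqxx. Qed.

Lemma degrees_inB P v w : degrees_in P v -> degrees_in P w -> degrees_in P (v - w).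
Proof.
move=> vP wP a m; rewrite !mxE mcoeffB.
have [v0|/vP//] := eqVneq (v 0 a)@_m 0; rewrite v0 sub0r oppr_eq0; exact: wP.
Qed.

Lemma homog_split j v : exists2 u, is_homog j u & degrees_in (fun l => l <> j) (v - u).
Proof.
pose u := \row_a \sum_(m <- msupp (v 0 a) | (mdeg m)%:Z + deg a == j)
  (v 0 a)@_m *: 'X_[m].
have uE a m : (u 0 a)@_m = if (mdeg m)%:Z + deg a == j then (v 0 a)@_m else 0.
  rewrite mxE (raddf_sum (mcoeff m)) /=.
  under eq_bigr do rewrite mcoeffZ mcoeffX.
  have [ms|ms] := boolP (m \in msupp (v 0 a)); last first.
    rewrite big1_seq => [|m' /andP[_ ms']].
      by rewrite (memN_msupp_eq0 ms) if_same.
    by case: eqP => [m'm|_]; [rewrite -m'm ms' in ms | rewrite mulr0].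
  rewrite big_mkcond (bigD1_seq m) ?msupp_uniq //= big1 ?addr0 ?eqxx ?mulr1 //.
  by move=> m' /negPf->; rewrite mulr0 if_same.
move: u uE => u uE; exists u => a m.
  by rewrite uE; case: ifP => [/eqP|_]; rewrite ?eqxx.
have -> : (v - u) 0 a = v 0 a - u 0 a by rewrite mxE [X in _ + X]mxE.
by rewrite mcoeffB uE; case: ifP => [_|/eqP]; rewrite ?subrr ?eqxx.
Qed.

Definition var_op (i : nat) v := ext_ord (fun j : 'I_n => 'X_j : S) i *: v.

Definition divdiff_op (i : nat) v : 'rV[S]_q :=
  if insub i is Some j then map_mx (divdiff j) v else 0.

Lemma var_opB i : {morph var_op i : a b / a - b}.
Proof. by move=> a b; apply: scalerBr. Qed.

Lemma var_opC i j v : var_op i (var_op j v) = var_op j (var_op i v).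
Proof. by rewrite /var_op !scalerA mulrC. Qed.

Lemma divdiff_opB i : {morph divdiff_op i : a b / a - b}.
Proof.
move=> a b; rewrite /divdiff_op; case: insub => [j|]; last by rewrite subrr.
apply/rowP => c; rewrite !mxE; apply/mpolyP => m.
by rewrite mcoeffB !mcoeff_divdiff mcoeffB.
Qed.

Lemma divdiff_var i v : (i < n)%N -> divdiff_op i (var_op i v) = v.
Proof.
move=> lt_in; rewrite /divdiff_op /var_op /ext_ord insubT.
apply/rowP => c; rewrite !mxE; apply/mpolyP => m.
by rewrite mcoeff_divdiff mcoeffXUM mnmDE mnm1E eqxx addn1 addmK.
Qed.

Lemma divdiff_var_comm i j v : i <> j ->
  divdiff_op i (var_op j v) = var_op j (divdiff_op i v).
Proof.
move=> ij; rewrite /divdiff_op /var_op /ext_ord.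
case: (insubP _ i) => [i' _ iE|_]; last by rewrite scaler0.
case: (insubP _ j) => [j' _ jE|_]; apply/rowP => c; rewrite !mxE; apply/mpolyP => m.
  have ij' : (i' == j') = false by apply/eqP => E; apply: ij; rewrite -iE -jE E.
  rewrite mcoeff_divdiff !mcoeffXUM mcoeff_divdiff mnmDE mnm1E ij' addn0.
  case: ifP => // /negbT mj; congr (_@_ _); apply/mnmP => l.
  rewrite !mnmDE !mnmBE mnmDE !mnm1E addnBAC //.
  by case: eqP => // <-; rewrite lt0n.
by rewrite mcoeff_divdiff !mul0r !mcoeff0.
Qed.

Lemma divdiff_opC i j v : divdiff_op i (divdiff_op j v) = divdiff_op j (divdiff_op i v).
Proof.
rewrite /divdiff_op; case: (insub i) => [i'|]; case: (insub j) => [j'|] //;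
  apply/rowP => c; rewrite !mxE; apply/mpolyP => m; rewrite ?mcoeff_divdiff ?mcoeff0 //.
by rewrite -!addmA [(U_(i') + _)%MM]addmC.
Qed.

Lemma var_op_homog i j v : is_homog j v -> is_homog (j + 1) (var_op i v).
Proof.
move=> vj a m; rewrite mxE /ext_ord; case: insubP => [l _ _|_]; last first.
  by rewrite mul0r mcoeff0 eqxx.
rewrite mcoeffXUM; case: ifP => [_|/negbT ml /vj <-]; first by rewrite eqxx.
by rewrite -{1}[m](@submK _ U_(l)) ?lep1mP // mdegD mdeg1 PoszD addrAC.
Qed.

Lemma divdiff_op_homog i j v : is_homog j v -> is_homog (j - 1) (divdiff_op i v).
Proof.
move=> vj a m; rewrite /divdiff_op; case: insubP => [l _ _|_]; last first.
  by rewrite mxE mcoeff0 eqxx.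
by rewrite mxE mcoeff_divdiff => /vj <-; rewrite mdegD mdeg1 PoszD addrAC addrK.
Qed.

(** If all divided differences vanish only constants remain, and these sit in the degrees of the
    basis vectors, below w. *)
Lemma homog_const w v : (forall a, deg a < w) -> is_homog w v ->
  (forall i, (i < n)%N -> divdiff_op i v = 0) -> v = 0.
Proof.
move=> degw vw Dv; apply/rowP => a; rewrite [RHS]mxE; apply/mpolyP => m.
rewrite mcoeff0; apply: contrapT => /eqP vm; have mw := vw a m vm.
have [i mi] : exists i, m i != 0%N.
  apply: contrapT => nex; have := degw a; rewrite -mw mdegE big1 ?add0r ?ltxx // => i _.
  by apply: contrapT => /eqP mi; apply: nex; exists i.
have := Dv i (ltn_ord i); rewrite /divdiff_op valK => /rowP/(_ a).
rewrite !mxE => /mpolyP/(_ (m - U_(i))%MM); rewrite mcoeff_divdiff mcoeff0.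
by rewrite submK ?lep1mP // => v0; rewrite v0 eqxx in vm.
Qed.

Lemma free_kexact w : (forall a, deg a < w) -> kexact var_op is_homog n w.
Proof.
move=> degw; apply: (@acyclic _ var_op divdiff_op n is_homog w).
- exact: var_opB.
- exact: var_opC.
- exact: divdiff_opB.
- exact: divdiff_var.
- exact: divdiff_var_comm.
- exact: divdiff_opC.
- by move=> j; apply: degrees_in0.
- by move=> j a b; apply: degrees_inB.
- by move=> i j v; apply: var_op_homog.
- by move=> i j v; apply: divdiff_op_homog.
by move=> v; apply: homog_const.
Qed.

End FreeModules.

Lemma degrees_in_mul (k : fieldType) n p q (deg : 'I_p -> int) (deg' : 'I_q -> int)
    (A : 'M[{mpoly k[n]}]_(p, q)) P v :
    (forall a c m, m \in msupp (A a c) -> (mdeg m)%:Z = deg a - deg' c) ->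
  degrees_in deg P v -> degrees_in deg' P (v *m A).
Proof.
move=> Adeg vP c m; rewrite mxE (raddf_sum (mcoeff m)) /= => nz.
have [a vA] : exists a, (v 0 a * A a c)@_m != 0.
  apply: contrapT => nex; case/eqP: nz; apply: big1 => a _.
  by apply: contrapT => /eqP va; apply: nex; exists a.
rewrite -mcoeff_msupp in vA; have /allpairsP[[m1 m2] /= [vm1 Am2 ->]] := msuppM_le vA.
rewrite mdegD PoszD (Adeg _ _ _ Am2) -addrA subrK.
by apply: vP; rewrite -mcoeff_msupp.
Qed.

Lemma aevalE (k : fieldType) (R : comAlgType k) n (e : 'I_n -> R) p :
  aeval e p = \sum_(m <- msupp p) (p@_m)%:A * aeval e 'X_[m].
Proof. by rewrite {1}/aeval /mmap; apply: eq_bigr => m _; rewrite /aeval mmapX. Qed.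

(** * From resolutions to Koszul exactness *)

Section Regularity.
Variables (k : fieldType) (R : homogAlg k) (n : nat) (e : 'I_n -> R).
Hypothesis e1 : forall a, e a \in hcomp R 1%N.

Definition gen_op (M : gmod R) (i : nat) (z : M) := ext_ord e i *: z.

(** Koszul homology in homological degree i and weight w is the degree i + w part of Tor_i(k, M)
    over S, so this says that the Betti numbers with j - i > r vanish. *)
Definition koszul_regular (M : gmod R) (r : int) := forall w : int, r < w ->
  kexact (@gen_op M) (fun j z => z \in gcomp M j) n w.

Lemma gen_opB M i : {morph @gen_op M i : a b / a - b}.
Proof. by move=> a b; apply: scalerBr. Qed.

Lemma gen_opC M i j v : @gen_op M i (@gen_op M j v) = gen_op j (gen_op i v).
Proof. by rewrite /gen_op !scalerA mulrC. Qed.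

Lemma gen_op_in M i j v : v \in gcomp M j -> @gen_op M i v \in gcomp M (j + 1).
Proof.
move=> vM; apply: scale1_in => //; rewrite /ext_ord; case: insubP => // _.
by case: (hcomp_grading R) => /(_ 1%N)[].
Qed.

Section Resolution.
Variables (M : gmod R) (F : freecx M n) (r : int).
Local Notation Fdeg i := (@rdeg k R M n F i).
Local Notation aug := (@augment k R M n e F).
Hypothesis Fres : is_minres e F.
Hypothesis Freg : forall i a, Fdeg i a <= r + i%:Z.

Lemma augmentB : {morph aug : u v / u - v}.
Proof.
move=> u v; rewrite /augment -sumrB; apply: eq_bigr => a _.
by rewrite !mxE [aeval e _]raddfB scalerBl.
Qed.

Lemma augment_var i v : aug (var_op i v) = gen_op i (aug v).
Proof.
rewrite /augment /gen_op scaler_sumr; apply: eq_bigr => a _.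
rewrite mxE aevalM scalerA /ext_ord; congr (_ * _ *: _).
by case: insub => [j|]; [exact: aevalX | exact: raddf0].
Qed.

Lemma gpr_augment P v l : degrees_in (Fdeg 0) P v -> ~ P l ->
  gpr l (aug v) = 0.
Proof.
move=> vP nPl; have [[gdeg _] _ _ _ _] := Fres.
rewrite /augment (big_morph _ (gprD l) (gpr0 _ l)) big1 // => a _.
rewrite aevalE scaler_suml.
rewrite (big_morph _ (gprD l) (gpr0 _ l)) big1_seq // => m /andP[_ ms].
rewrite -scalerA; apply: (gpr_out (i := (mdeg m)%:Z + Fdeg 0 a)).
  by move=> ml; apply: nPl; rewrite -ml; apply: vP; rewrite -mcoeff_msupp.
apply: scalek_in; apply: gcomp_scale => //; exact: aeval_homog.
Qed.

Lemma gcomp_gpr j (z : M) : (forall l, l <> j -> gpr l z = 0) -> z \in gcomp M j.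
Proof.
move=> zj; suff -> : z = gpr j z by apply: gpr_in.
apply/eqP; rewrite -subr_eq0; apply/eqP/gpr_eq0 => l; rewrite gprB.
have [->|/eqP lj] := eqVneq l j; first by rewrite (gpr_id (gpr_in _ _)) subrr.
by rewrite zj // (gpr_out _ (gpr_in j z)) ?subrr // => jl; apply: lj.
Qed.

Lemma augment_homog j v : is_homog (Fdeg 0) j v -> aug v \in gcomp M j.
Proof. by move=> vj; apply: gcomp_gpr => l; apply: gpr_augment vj. Qed.

Lemma augment_lift j z : z \in gcomp M j ->
  exists2 v, is_homog (Fdeg 0) j v & aug v = z.
Proof.
have [_ /(_ z)[v <-] _ _ _ zM] := Fres.
have [u uj vu] := homog_split (Fdeg 0) j v; exists u => //.
rewrite -[LHS](gpr_id (augment_homog uj)) -[RHS](gpr_id zM).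
apply/eqP; rewrite eq_sym -subr_eq0 -gprB -augmentB; apply/eqP.
by apply: (gpr_augment vu); apply.
Qed.

(** Taken as a kernel: F_(i+1) maps onto [syzygy] i with kernel [syzygy] i + 1, the situation of
    [dimension_shift]. *)
Definition syzygy i : 'rV[{mpoly k[n]}]_(rk F i) -> Prop :=
  match i with
  | 0 => fun v => aug v = 0
  | i'.+1 => fun v => v *m rmx F i' = 0
  end.

Lemma syzygyP i v : @syzygy i v <-> exists u, v = u *m rmx F i.
Proof.
by have [_ _ ex0 exS _] := Fres; case: i v => [|i] v; [apply: ex0 | apply: exS].
Qed.

Lemma rmx_homog i j v :
  is_homog (Fdeg i.+1) j v -> is_homog (Fdeg i) j (v *m rmx F i).
Proof. by have [[_ rmx_deg] _ _ _ _] := Fres; apply: degrees_in_mul; apply: rmx_deg. Qed.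

Lemma syzygy_lift i j v : is_homog (Fdeg i) j v /\ syzygy v ->
  exists2 u, is_homog (Fdeg i.+1) j u & u *m rmx F i = v.
Proof.
have [[_ rmx_deg] _ _ _ _] := Fres.
move=> [vj /syzygyP[u vE]]; have [u' u'j uu'] := homog_split (Fdeg i.+1) j u.
exists u' => //; apply/eqP; rewrite eq_sym -subr_eq0; apply/eqP/rowP => c.
rewrite [RHS]mxE; apply/mpolyP => m; rewrite mcoeff0.
apply: contrapT => /eqP nz.
(* A monomial of the difference would have degree j, both terms being homogeneous, and a degree
   other than j, the difference being the image of u - u'. *)
have E := degrees_inB vj (rmx_homog u'j) nz.
by rewrite vE -mulmxBl in nz; apply: (degrees_in_mul (rmx_deg i) uu' nz E).
Qed.

(** The generators of F_(i+1) have degrees at most r + i + 1, so that free module is exact at w. A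
    shift raises i and w by one, which preserves the bound, and lowers q; at q = 0 the cycle is
    zero. *)
Lemma syzygy_kfexact q i (w : int) : r + i.+1%:Z < w ->
  kfexact (@var_op k n _) (fun j v => is_homog (Fdeg i) j v /\ syzygy v) n q w.
Proof.
elim: q i w => [|q IH] i w lt_w.
  move=> a _ /kfil0 -> _; exists 0; last by apply: kd0 => l; apply: var_opB.
  apply: kall0; split; first exact: degrees_in0.
  by apply/syzygyP; exists 0; rewrite mul0mx.
apply: (@dimension_shift _ _ (@var_op k n _) _ (mulmx^~ (rmx F i))
  (is_homog (Fdeg i.+1))).
- exact: var_opB.
- exact: var_opC.
- by move=> u v; apply: mulmxBl.
- by move=> l v; rewrite /var_op scalemxAl.
- by move=> j; apply: degrees_in0.
- by move=> j a b; apply: degrees_inB.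
- by move=> l j v; apply: var_op_homog.
- by move=> j v vj; split; [apply: rmx_homog | apply/syzygyP; exists v].
- by move=> v; apply: syzygy_lift.
- by apply: free_kexact => a; exact: (le_lt_trans (Freg a) lt_w).
by apply: IH; rewrite -addn1 PoszD addrA ltrD2r.
Qed.

Lemma resolution_koszul_regular : koszul_regular M r.
Proof.
move=> w lt_rw a Ma da.
have /(_ n) := @dimension_shift _ _ (@var_op k n _) (@gen_op M) aug
  (is_homog (Fdeg 0)) (fun j z => z \in gcomp M j) n _ w.
apply; rewrite ?kfil_full //.
- exact: var_opB.
- exact: var_opC.
- exact: augmentB.
- exact: augment_var.
- by move=> j; apply: degrees_in0.
- by move=> j b c; apply: degrees_inB.
- by move=> l j v; apply: var_op_homog.
- by move=> j v; apply: augment_homog.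
- by move=> v; apply: augment_lift.
- by apply: free_kexact => c; apply: (le_lt_trans (Freg c)); rewrite addr0.
- by apply: (@syzygy_kfexact n 0); rewrite ltrD2r.
exact: kfil_full.
Qed.

End Resolution.

End Regularity.

(** * Regularity of quotients and Hilbert functions *)

Section Koszul.
Variables (k : fieldType) (R : homogAlg k) (n : nat) (e : 'I_n -> R).
Hypothesis e1 : forall a, e a \in hcomp R 1%N.
Hypothesis e_gen : forall x, exists p, aeval e p = x.
Variable r : int.
Implicit Types N : gmod R.

Definition quotient_map N N' (K : N -> Prop) (f : {linear N -> N'}) :=
  [/\ forall y, exists z, f z = y, forall z, f z = 0 <-> K z &
      forall j y, y \in gcomp N' j <-> exists2 z, z \in gcomp N j & f z = y].

Lemma quotient_map_is N N' (K : N -> Prop) (f : {linear N -> N'}) :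
  quotient_map K f -> is_quotient K N'.
Proof.
by case=> f_surj fK fG; exists f; split=> // j z zN; apply/fG; exists z.
Qed.

(** A socle element is a cycle in the top homological degree n, where no boundaries exist. *)
Lemma socle_bound N j (z : N) : koszul_regular e N r -> r < j ->
  z \in gcomp N j -> (forall i, e i *: z = 0) -> z = 0.
Proof.
move=> regN lt_rj zN sz; have [||b _ db] := regN j lt_rj (ktopc n z).
- by apply: kall_topc => //; apply: gcomp0.
- by apply: kd_topc => [i|i lt_in]; [apply: gen_opB | rewrite /gen_op /ext_ord insubT].
by rewrite -(ktopcK n z) -db ktop_kd.
Qed.

(** In homological degree 0 every element is a cycle, and what it bounds has coefficients in degree
    j - 1. *)
Lemma generated_bound N j : koszul_regular e N r -> r < j ->
    (forall z, z \in gcomp N (j - 1) -> z = 0) ->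
  forall z, z \in gcomp N j -> z = 0.
Proof.
move=> regN lt_rj N0 z zN; have [||b bN db] := regN j lt_rj (kbotc n z).
- by apply: kall_botc => //; apply: gcomp0.
- by apply: kd_botc => i; apply: gen_opB.
have b0 : b = 0 by apply/kall_eq0; apply: kall_impl bN.
by apply: (@kbotc_inj _ n); rewrite -db b0 kd0 // => i; apply: gen_opB.
Qed.

(** Multiplying by a generator lowers the exponent t and moves further above r; when all multiples
    vanish, z is in the socle. *)
Lemma Gamma_bound N j (z : N) : koszul_regular e N r -> r < j ->
  z \in gcomp N j -> Gamma z -> z = 0.
Proof.
move=> regN lt_rj zN /(GammaP e1 e_gen)[t].
elim: t j z lt_rj zN => [|t IH] j z lt_rj zN Kz.
  by have := Kz [::] erefl; rewrite big_nil scale1r.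
apply: (socle_bound regN lt_rj zN) => i; apply: (IH (j + 1)).
- by apply: lt_trans lt_rj _; rewrite ltrDl.
- exact: scale1_in.
exact: (proj1 (killedS e t z) Kz).
Qed.

(** Lift the cycle to a. Its boundary has weight w + 1 and is x c with c of weight w; c is a cycle
    as x is regular, so c is the boundary of some b, and a - x b is a cycle of N with the same
    image. *)
Lemma koszul_regular_hyperplane N N' x (f : {linear N -> N'}) :
    x \in hcomp R 1%N -> regular_elt N x -> koszul_regular e N r ->
  quotient_map (seq_submod [:: x]) f -> koszul_regular e N' r.
Proof.
move=> x1 x_reg regN [f_surj fK fG] w lt_rw a' a'N da'.
have fB : {morph f : u v / u - v} by apply: raddfB.
have f_op i v : f (gen_op e i v) = gen_op e i (f v) by apply: linearZ.
have xB : {morph (fun v : N => x *: v) : u v / u - v} by move=> u v; apply: scalerBr.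
have opB := @gen_opB _ _ _ e N.
have opC := @gen_opC _ _ _ e N.
have x_op i v : x *: (gen_op e i v : N) = gen_op e i (x *: v).
  by rewrite /gen_op !scalerA mulrC.
have fG' v : v \in gcomp N' w -> exists2 u, u \in gcomp N w & f u = v by move/fG.
have [a aN fa] := kall_lift fG' a'N.
have [c cN xc] : exists2 c : kz N n, kall (fun v => v \in gcomp N w) c &
    kmap (fun v => x *: v) c = kd (@gen_op _ _ _ e N) a.
  have Q v : v \in gcomp N (w + 1) /\ f v = 0 ->
      exists2 u, u \in gcomp N w & x *: u = v.
    move=> [vN /fK/seq_submodE[u vE]]; exists (gpr w u); first exact: gpr_in.
    by rewrite -[RHS](gpr_id vN) vE gpr_scale1 // addrK.
  apply: (kall_lift Q); apply: kall_and.
    apply: kall_kd aN; [exact: gcomp0 | exact: gcompB | move=> i v].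
    exact: gen_op_in.
  apply/(kall_map f (fun v => v = 0)).
  by rewrite -(kd_kmap _ fB f_op) fa da'; apply: kall0.
have dc : kd (@gen_op _ _ _ e N) c = 0.
  apply: kall_eq0.
  have : kall (fun v => x *: v = 0) (kd (@gen_op _ _ _ e N) c).
    apply/(kall_map (fun v => x *: v) (fun v => v = 0)).
    rewrite -(kd_kmap _ xB x_op) xc kdd //; exact: kall0.
  by apply: kall_impl => v; apply: x_reg.
have [b bN db] := regN w lt_rw c cN dc.
have [||b2 b2N db2] := regN w lt_rw (a - kmap (fun v => x *: v) b).
- apply: kallB => //; first by move=> u v; apply: gcompB.
  apply/kall_map; apply: kall_impl bN => v vN.
  by rewrite -[w](subrK 1) scale1_in.
- by rewrite kdB // (kd_kmap _ xB x_op) db xc subrr.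
exists (kmap f b2).
  by apply/kall_map; apply: kall_impl b2N => v vN; apply/fG; exists v.
rewrite (kd_kmap _ fB f_op) db2 kmapB // fa kmap_comp.
suff -> : kmap (f \o (fun v => x *: v)) b = 0 by rewrite subr0.
apply/kall_eq0/kall_map; have: kall (fun=> True) b by apply: kall_impl bN.
by apply: kall_impl => v _ /=; apply/fK/seq_submodE; exists v.
Qed.

(** The boundary of a lift is torsion of weight w + 1 > r, hence zero by [Gamma_bound]: every lift
    is already a cycle. *)
Lemma koszul_regular_torsion N N' (f : {linear N -> N'}) :
    koszul_regular e N r -> quotient_map (@Gamma _ _ N) f ->
  koszul_regular e N' r.
Proof.
move=> regN [f_surj fK fG] w lt_rw a' a'N da'.
have fB : {morph f : u v / u - v} by apply: raddfB.
have f_op i v : f (gen_op e i v) = gen_op e i (f v) by apply: linearZ.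
have fG' v : v \in gcomp N' w -> exists2 u, u \in gcomp N w & f u = v by move/fG.
have [a aN fa] := kall_lift fG' a'N.
have [|b bN db] := regN w lt_rw a aN.
  apply: kall_eq0.
  have : kall (fun v => v \in gcomp N (w + 1) /\ f v = 0) (kd (@gen_op _ _ _ e N) a).
    apply: kall_and.
      apply: kall_kd aN; [exact: gcomp0 | exact: gcompB | move=> i v].
      exact: gen_op_in.
    apply/(kall_map f (fun v => v = 0)).
    by rewrite -(kd_kmap _ fB f_op) fa da'; apply: kall0.
  apply: kall_impl => v [vN /fK]; apply: Gamma_bound vN => //.
  by apply: lt_trans lt_rw _; rewrite ltrDl.
exists (kmap f b); last by rewrite (kd_kmap _ fB f_op) db.
by apply/kall_map; apply: kall_impl bN => v vN; apply/fG; exists v.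
Qed.

Lemma Gamma_quotient N N' (f : {linear N -> N'}) (y : N') :
  quotient_map (@Gamma _ _ N) f -> Gamma y -> y = 0.
Proof.
move=> [f_surj fK _] /(GammaP e1 e_gen)[t]; have [z <-] := f_surj y => Kfz.
apply/fK/(GammaP e1 e_gen).
have /choice[tau tauP] (s : t.-tuple 'I_n) :
    exists t', killed e t' ((\prod_(i <- s) e i) *: z).
  by apply/(GammaP e1 e_gen)/fK; rewrite linearZ /= Kfz // size_tuple.
exists (t + \max_s tau s)%N; apply: killed_prod => s /eqP st.
apply: killed_mono (tauP (Tuple st)); exact: (leq_bigmax (Tuple st)).
Qed.

End Koszul.

(** * Hilbert functions, torsion and length *)

Section HilbertFunction.
Variables (k : fieldType) (R : homogAlg k).
Implicit Types N : gmod R.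

Definition locally_finite N := forall j,
  exists D, spannable (fun z : kmod N => z \in gcomp N j) D.

Definition bounded_below N := exists j0 : int,
  forall j, j < j0 -> forall z, z \in gcomp N j -> z = 0.

Lemma linear_kmod N N' (f : {linear N -> N'}) (a : k) (v : kmod N) :
  f (a *: v) = a *: (f v : kmod N') :> kmod N'.
Proof. exact: (linearZ_LR f (a%:A : R) (v : N)). Qed.

Lemma kmod_scaleC N (x : R) (a : k) (v : kmod N) :
  x *: ((a *: v : kmod N) : N) = (a *: (x *: (v : N) : kmod N) : kmod N).
Proof.
by rewrite -[LHS]/(x *: (a%:A *: (v : N))) -[RHS]/(a%:A *: (x *: (v : N))) !scalerA mulrC.
Qed.

Lemma locally_finite_quotient N N' (K : N -> Prop) (f : {linear N -> N'}) :
  quotient_map K f -> locally_finite N -> locally_finite N'.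
Proof.
move=> [_ _ fG] Nfin j; have [D ND] := Nfin j; exists D.
apply: (@spannable_map _ (kmod N) (kmod N') f) ND => [u v|a v|w /fG//].
  exact: raddfD.
exact: linear_kmod.
Qed.

Lemma bounded_below_quotient N N' (K : N -> Prop) (f : {linear N -> N'}) :
  quotient_map K f -> bounded_below N -> bounded_below N'.
Proof.
move=> [_ _ fG] [j0 N0]; exists j0 => j lt_j _ /fG[z zN <-].
by rewrite (N0 j lt_j z zN) raddf0.
Qed.

Lemma submodule_kmod N (K : N -> Prop) :
  submodule K -> subspace (fun z : kmod N => K z).
Proof.
move=> Ksub; split=> [|u v|a v]; [exact: (submod0 Ksub) | exact: (submodD Ksub) |].
exact: (submodZ Ksub).
Qed.

(** As x is regular, x times a basis of degree j - 1 is a free family in the kernel. *)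
Lemma hilb_hyperplane N N' x (f : {linear N -> N'}) (j : int) :
    x \in hcomp R 1%N -> regular_elt N x -> locally_finite N ->
    quotient_map (seq_submod [:: x]) f ->
  (hilb N (j - 1) + hilb N' j <= hilb N j)%N.
Proof.
move=> x1 x_reg Nfin [_ fK fG]; have [D ND] := Nfin j; have [D' ND'] := Nfin (j - 1).
have [b [bN b_free _]] := vdim_basis (gcomp_subspace N (j - 1)) ND'.
apply: (@vdim_add_le _ (kmod N) (kmod N') f _ (fun i => x *: (b i : N)) _ _ D) => //.
- by move=> u v; exact: (raddfD f).
- exact: linear_kmod.
- exact: gcomp_subspace.
- exact: gcomp_subspace.
- move=> c c0; apply: b_free; apply: (x_reg); rewrite -[RHS]c0 /lincomb scaler_sumr.
  by apply: eq_bigr => i _; apply: kmod_scaleC.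
- by move=> i; rewrite -[j](subrK 1) scale1_in.
- by move=> i; apply/fK/seq_submodE; exists (b i).
by move=> w /fG.
Qed.

(** Telescoping; the leftover H(N; j - L) is dropped. *)
Lemma hilb_hyperplane_sum N N' x (f : {linear N -> N'}) L (j : int) :
    x \in hcomp R 1%N -> regular_elt N x -> locally_finite N ->
    quotient_map (seq_submod [:: x]) f ->
  (\sum_(i < L) hilb N' (j - i%:Z) <= hilb N j)%N.
Proof.
move=> x1 x_reg Nfin fP; elim: L j => [|L IH] j; first by rewrite big_ord0.
rewrite big_ord_recl /= subr0 addnC.
apply: leq_trans (hilb_hyperplane j x1 x_reg Nfin fP).
rewrite leq_add2r; apply: leq_trans (IH (j - 1)); apply: eq_leq.
by apply: eq_bigr => i _; rewrite /bump /= add1n -addn1 PoszD opprD addrCA addrC.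
Qed.

Definition Gamma_comp N j : {pred kmod N} :=
  fun z => `[<z \in gcomp N j /\ Gamma (z : N)>].

Arguments Gamma_comp N j : clear implicits.

Lemma Gamma_compP N j (z : N) :
  (z : kmod N) \in Gamma_comp N j <-> z \in gcomp N j /\ Gamma z.
Proof. by split=> /asboolP. Qed.

Section TorsionPart.
Variables (n : nat) (e : 'I_n -> R).
Hypothesis e1 : forall a, e a \in hcomp R 1%N.
Hypothesis e_gen : forall x, exists p, aeval e p = x.

Lemma Gamma_comp_subspace N j : subspace (fun z => z \in Gamma_comp N j).
Proof.
have [G0 GD GZ] := submodule_kmod (Gamma_submodule e1 e_gen N).
have [N0 ND NZ] := gcomp_subspace N j.
split=> [|u v /Gamma_compP[uN uG] /Gamma_compP[vN vG]|a v /Gamma_compP[vN vG]];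
  apply/Gamma_compP; split; by [|apply: ND|apply: GD|apply: NZ|apply: GZ].
Qed.

Lemma Gamma_comp_spannable N j : locally_finite N ->
  spannable (fun z => z \in Gamma_comp N j) (vdim (Gamma_comp N j)).
Proof.
move=> /(_ j)[D [b bP]]; apply: vdim_spannable (Gamma_comp_subspace N j) _.
by exists b => v /Gamma_compP[/bP].
Qed.

Lemma hilb_torsion N N' (f : {linear N -> N'}) (j : int) :
    locally_finite N -> quotient_map (@Gamma _ _ N) f ->
  (vdim (Gamma_comp N j) + hilb N' j <= hilb N j)%N.
Proof.
move=> Nfin [_ fK fG]; have [D ND] := Nfin j.
have [b [bN b_free _]] :=
  vdim_basis (Gamma_comp_subspace N j) (Gamma_comp_spannable j Nfin).
apply: (@vdim_add_le _ (kmod N) (kmod N') f _ b _ _ D) => //.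
- by move=> u v; exact: (raddfD f).
- exact: linear_kmod.
- exact: gcomp_subspace.
- exact: gcomp_subspace.
- by move=> i; have /Gamma_compP[] := bN i.
- by move=> i; apply/fK; have /Gamma_compP[] := bN i.
by move=> w /fG.
Qed.

Lemma gpr_range N (r : int) L (z : N) :
    (forall j, r < j -> gpr j z = 0) -> (forall j, j <= r - L%:Z -> gpr j z = 0) ->
  z = \sum_(i < L) gpr (r - i%:Z) z.
Proof.
move=> z_hi z_lo; apply/eqP; rewrite -subr_eq0; apply/eqP/gpr_eq0 => j.
have inj_r : injective (fun i : nat => r - i%:Z).
  by move=> i i' /addrI/oppr_inj[].
rewrite gprB -(big_mkord xpredT (fun i => gpr (r - i%:Z) z)).
rewrite -(big_map (fun i : nat => r - i%:Z) xpredT (fun l => gpr l z)).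
rewrite gpr_big; [|by rewrite map_inj_uniq // iota_uniq|by move=> l; apply: gpr_in].
case: ifP => [_|/negP jL]; first by rewrite subrr.
rewrite subr0; have [lt_rj|le_jr] := ltP r j; first exact: z_hi.
apply: z_lo; rewrite leNgt; apply/negP => lt_j; apply: jL.
have dE : r - (`|r - j|)%N%:Z = j by rewrite gez0_abs ?subr_ge0 // subKr.
apply/mapP; exists `|r - j|%N => //; rewrite mem_index_iota /= -ltz_nat.
by rewrite gez0_abs ?subr_ge0 // ltrBlDr addrC -ltrBlDr.
Qed.

Lemma modlength_le N (K : N -> Prop) D :
  spannable (fun z : kmod N => K z) D -> (modlength K <= D)%N.
Proof.
move=> [b bP]; rewrite /modlength /natmax.
(* Either the default 0, or a length m attained by a strict chain; one new element per step of the
   chain gives a free family over k. *)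
case: xgetP => // m _ [[P [Psub PK Pstrict]] _].
have /choice[z zP] i : exists z : N, (i < m)%N -> z \in P i.+1 /\ z \notin P i.
  have [im|] := ltnP i m; last by exists 0.
  by have [_ [z]] := Pstrict i im; exists z.
have z_free : lin_free (fun i : 'I_m => z i : kmod N).
  apply: (@chain_free _ (kmod N) (fun i v => (v : N) \in P i)).
  - move=> i /ltnW/Psub[P0 PD]; split=> // [u v uP vP|a v vP].
      by have := PD 1 u v uP vP; rewrite scale1r.
    by have := PD a%:A v 0 vP P0; rewrite addr0.
  - by move=> i v /ltnW/Pstrict[+ _]; apply.
  - by move=> i /ltnW/zP[].
  - by move=> i /zP[_ /negP].
apply: (lin_free_le (e := b)) z_free _ => i; apply: bP.
by apply: (PK i.+1) => //; case: (zP i (ltn_ord i)).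
Qed.

Lemma modlength_Gamma_le N (r : int) L : koszul_regular e N r -> locally_finite N ->
    (forall j, j <= r - L%:Z -> forall z, z \in gcomp N j -> z = 0) ->
  (modlength (@Gamma _ _ N) <= \sum_(i < L) vdim (Gamma_comp N (r - i%:Z)))%N.
Proof.
move=> regN Nfin N_lo; apply: modlength_le.
have := spannable_sum L (fun i => Gamma_comp_spannable (r - i%:Z) Nfin).
apply: (@spannable_map _ (kmod N) (kmod N) id) => // z Gz; exists z => //.
have zG j := Gamma_gpr e1 e_gen j Gz.
exists (fun i => gpr (r - i%:Z) (z : N)) => [i|].
  by apply/Gamma_compP; split=> //; apply: gpr_in.
apply: gpr_range => j lt_j; last exact: N_lo lt_j _ (gpr_in _ _).
exact: (Gamma_bound e1 e_gen regN lt_j (gpr_in _ _)).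
Qed.

End TorsionPart.

End HilbertFunction.

(** * Finiteness read off a resolution *)

Section Resolution.
Variables (k : fieldType) (R : homogAlg k) (n : nat) (e : 'I_n -> R).
Hypothesis e1 : forall a, e a \in hcomp R 1%N.
Variables (M : gmod R) (F : freecx M n).
Hypothesis Fres : is_minres e F.

Lemma resolution_bounded_below : bounded_below M.
Proof.
(* A lower bound for all generator degrees. *)
exists (- \sum_a `|rdeg (f := F) (i := 0) a|) => j lt_j z zM.
have [v vj <-] := augment_lift e1 Fres zM.
suff -> : v = 0 by rewrite -[X in augment e X](subrr 0) augmentB subrr.
apply/rowP => a; rewrite [RHS]mxE; apply/mpolyP => m; rewrite mcoeff0.
apply: contrapT => /eqP /(vj a m) mj; move: lt_j; rewrite -mj; apply/negP.
rewrite -leNgt lerNl opprD; apply: le_trans (_ : `|rdeg (f := F) (i := 0) a| <= _).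
  rewrite -[leRHS]add0r lerD ?oppr_le0 // -normrN; exact: ler_norm.
by rewrite (bigD1 a) //= lerDl sumr_ge0.
Qed.

Lemma resolution_locally_finite : locally_finite M.
Proof.
(* A monomial in the a-th coordinate of an element of degree j has degree j - [rdeg] a, below b. *)
move=> j; pose b := (\sum_a `|j - rdeg (f := F) (i := 0) a|).+1%N.
pose T : finType := ('I_(rk F 0) * 'X_{1..n < b})%type.
exists #|T|; apply: (@spannable_fin _ (kmod M) _ T
  (fun t : T => aeval e 'X_[t.2] *: rgen (f := F) t.1)) => z.
move=> /(augment_lift e1 Fres)[v vj <-].
exists (fun t : T => (v 0 t.1)@_t.2).
rewrite -(pair_bigA _ (fun a (m : 'X_{1..n < b}) => (v 0 a)@_m *:
  (aeval e 'X_[m] *: rgen (f := F) a : kmod M))) /=; apply: eq_bigr => a _.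
rewrite /aeval (@mmapE _ _ _ _ _ _ b); last first.
  rewrite msizeE; apply/bigmax_leqP_seq => m ms _.
  rewrite ltnS (bigD1 a) //=; apply: leq_trans (leq_addr _ _).
  by have := vj a m; rewrite -mcoeff_msupp => /(_ ms) <-; rewrite addrK.
rewrite scaler_suml; apply: eq_bigr => m _.
by rewrite mmapX -scalerA.
Qed.

End Resolution.

(** Positive dimension is excluded because the annihilator contains 1, which lies in no prime ideal;
    what remains is the length. *)
Lemma mult_zero (k : fieldType) (R : homogAlg k) (N : gmod R) b :
  (forall z : N, z = 0) -> has_mult N b -> b = 0%N.
Proof.
move=> N0 [[_ ->]|[d [p [[[P [Pid Pann _]] _] _ _]]]].
  apply/eqP; rewrite -leqn0; apply: modlength_le.
  exists (fun=> 0) => z _; exists 0; rewrite /lincomb big_ord0; exact: N0.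
have [[_ P1 _] _] := Pid 0%N (leq0n _).
by case/negP: P1; apply: Pann => z; rewrite [z]N0 scaler0.
Qed.

Lemma depth_ge1_neq0 (k : fieldType) (R : homogAlg k) (N : gmod R) :
  depth_ge N 1 -> exists z : N, z <> 0.
Proof.
move=> [s _ [_ _ [z nz]]]; exists z => z0; apply: nz; rewrite z0.
by exists (fun=> 0); rewrite big1 // => i _; rewrite scaler0.
Qed.

(** Graded Nakayama: if N = x N, then each component is x times one a degree lower, hence zero from
    the bottom upwards. *)
Lemma regular_depth_ge1 (k : fieldType) (R : homogAlg k) (N : gmod R) (x : R) :
    x \in hcomp R 1%N -> regular_elt N x -> bounded_below N ->
    (exists z : N, z <> 0) -> depth_ge N 1.
Proof.
move=> x1 x_reg [j0 N_lo] [z z0]; exists [:: x] => //; split.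
- by move=> a; rewrite inE => /eqP->; apply: degree1_irrelevant.
- case=> // _ y /= [c]; rewrite big_ord0 => /x_reg ->.
  by exists (fun=> 0); rewrite big_ord0.
apply: contrapT => /forallNP divx; apply: z0; apply: gpr_eq0.
suff main i : forall y : N, gpr (j0 + (i%:Z - 1)) y = 0.
  move=> j; have [lt_j|le_j] := ltP j j0; first exact: N_lo lt_j _ (gpr_in _ _).
  have := main `|j - j0|.+1 z; rewrite -addn1 PoszD addrK gez0_abs ?subr_ge0 //.
  by rewrite subrKC.
elim: i => [|i IH] y.
  by apply: N_lo (gpr_in _ _); rewrite sub0r gtrDl oppr_lt0.
have /contrapT/seq_submodE[y' ->] := divx y.
by rewrite gpr_scale1 // -addrA -addn1 PoszD addrK IH scaler0.
Qed.

(** Vanishing in degree r spreads upwards by generation and downwards by injectivity of x. *)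
Lemma top_comp_eq0 (k : fieldType) (R : homogAlg k) n (e : 'I_n -> R) (r : int)
    (N : gmod R) (x : R) :
    koszul_regular e N r -> x \in hcomp R 1%N -> regular_elt N x ->
  (forall z, z \in gcomp N r -> z = 0) -> forall z : N, z = 0.
Proof.
move=> regN x1 x_reg Nr z; apply: gpr_eq0 => j.
have up i : forall y, y \in gcomp N (r + i%:Z) -> y = 0.
  elim: i => [|i IH]; first by rewrite addr0.
  apply: (generated_bound regN); first by rewrite ltrDl.
  by rewrite -addn1 PoszD addrA addrK.
have down i : forall y, y \in gcomp N (r - i%:Z) -> y = 0.
  elim: i => [|i IH] y yN; first by apply: Nr; rewrite -[r]subr0.
  apply: x_reg; apply: IH.
  have -> : r - i%:Z = r - i.+1%:Z + 1 by rewrite -addn1 PoszD opprD addrA subrK.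
  exact: scale1_in.
have [le_rj|/ltW le_jr] := leP r j.
  apply: (up `|j - r|%N); rewrite gez0_abs ?subr_ge0 // subrKC; exact: gpr_in.
apply: (down `|r - j|%N); rewrite gez0_abs ?subr_ge0 // subKr; exact: gpr_in.
Qed.

(** * The induction *)

Section Main.
Variables (k : fieldType) (R : homogAlg k) (n : nat) (e : 'I_n -> R).
Hypothesis kinf : infinite_set [set: k]%classic.
Hypothesis e1 : forall a, e a \in hcomp R 1%N.
Hypothesis e_gen : forall x, exists p, aeval e p = x.
Variables (bdeg : gmod R -> nat) (r : int).
Hypothesis bdegP : is_bdeg bdeg.

Lemma bdeg_zero (N : gmod R) : (forall z : N, z = 0) -> bdeg N = 0%N.
Proof.
move=> N0; have [_ [U _ [bCM _ _]]] := bdegP.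
by apply: (mult_zero N0); apply: bCM; left.
Qed.

Lemma seq_submod_submodule (N : gmod R) (x : R) : submodule (@seq_submod _ _ N [:: x]).
Proof.
split=> [|a b /seq_submodE[u ->] /seq_submodE[v ->]|c a /seq_submodE[u ->]];
  apply/seq_submodE.
- by exists 0; rewrite scaler0.
- by exists (u - v); rewrite scalerBr.
by exists (c *: u); rewrite !scalerA mulrC.
Qed.

Lemma seq_submod_homog (N : gmod R) (x : R) (s : seq int) (c : int -> N) :
    x \in hcomp R 1%N -> uniq s -> (forall i, c i \in gcomp N i) ->
    seq_submod [:: x] (\sum_(i <- s) c i) ->
  {in s, forall i, seq_submod [:: x] (c i)}.
Proof.
move=> x1 us cN /seq_submodE[y yE] i si; apply/seq_submodE.
by exists (gpr (i - 1) y); rewrite -gpr_scale1 // -yE gpr_big // si.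
Qed.

Lemma bdeg_le h (N : gmod R) : (hilb N (r + 1) < h)%N ->
    koszul_regular e N r -> locally_finite N -> bounded_below N -> depth_ge N 1 ->
  (bdeg N <= hilb N r)%N.
Proof.
elim: h N => // h IH N hN regN Nfin Nlow Ndepth.
have [_ [U [_ U1 Uopen Ureg] [_ bGamma bhyp]]] := bdegP.
have [x Ux] : exists x, U N x by have [O [_ [x Ox] OU]] := Uopen N; exists x; apply: OU.
have x1 := U1 _ _ Ux; have x_reg := Ureg N Ndepth x Ux.
have hr : (0 < hilb N r)%N.
  rewrite lt0n; apply/eqP => hr0; have [D ND] := Nfin r.
  have [z] := depth_ge1_neq0 Ndepth; apply.
  apply: (top_comp_eq0 regN x1 x_reg) => {}z.
  exact: (vdim_eq0 (gcomp_subspace N r) ND hr0).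
have [N1 [f fP]] := graded_quotient (seq_submod_submodule N x)
  (fun s c => seq_submod_homog x1).
have h1 := hilb_hyperplane (r + 1) x1 x_reg Nfin fP; rewrite addrK in h1.
have reg1 := koszul_regular_hyperplane e1 x1 x_reg regN fP.
have fin1 := locally_finite_quotient fP Nfin.
have low1 := bounded_below_quotient fP Nlow.
have [N2 [g gP]] := graded_quotient (Gamma_submodule e1 e_gen N1)
  (fun s c => @Gamma_homog _ _ _ _ e1 e_gen N1 s c).
have reg2 := koszul_regular_torsion e1 e_gen reg1 gP.
have fin2 := locally_finite_quotient gP fin1.
have low2 := bounded_below_quotient gP low1.
rewrite (bhyp N x Ndepth Ux N1 (quotient_map_is fP)) (bGamma N1 N2 (quotient_map_is gP)).
have b2 : (bdeg N2 <= hilb N2 r)%N.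
  (* The zero module has no positive depth, so it escapes the induction hypothesis; its [bdeg] is
     0. *)
  have [N2_0|/existsNP N2_neq0] := pselect (forall z : N2, z = 0).
    by rewrite bdeg_zero.
  have [|y y1 y_reg] := @regular_linear_form _ _ _ _ e1 e_gen N2 kinf.
    move=> z ez; apply: (Gamma_quotient e1 e_gen gP); apply/(GammaP e1 e_gen).
    exists 1%N; apply/killedS => i; rewrite ez; exact: submod0 (killed_submodule e N2 0).
  apply: IH => //; last first.
    exact: (regular_depth_ge1 y1 y_reg low2).
  (* H(N2; r + 1) <= H(N1; r + 1) <= H(N; r + 1) - H(N; r), a strict drop by [hr]. *)
  have h2 := hilb_torsion e1 e_gen (r + 1) fin1 gP.
  rewrite -ltnS; apply: leq_trans hN; rewrite ltnS; apply: leq_trans h1.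
  rewrite -[X in (X <= _)%N]add1n; apply: leq_add hr _.
  exact: leq_trans (leq_addl _ _) h2.
have [j0 low1'] := low1.
(* Makes r - L < j0, so the L degrees from r downwards hold all the torsion of N1. *)
pose L := `|r - j0|.+1%N.
have lowL j : j <= r - L%:Z -> forall z, z \in gcomp N1 j -> z = 0.
  move=> le_j; apply: low1'; apply: le_lt_trans le_j _.
  rewrite ltrBlDr /L -addn1 PoszD addrA ltzD1 -lerBlDl; exact: ler_norm.
apply: leq_trans (hilb_hyperplane_sum L r x1 x_reg Nfin fP).
have tors := modlength_Gamma_le e1 e_gen reg1 fin1 lowL.
apply: leq_trans (leq_add b2 tors) _.
apply: leq_trans (leq_sum _ (fun (i : 'I_L) _ =>
  hilb_torsion e1 e_gen (r - i%:Z) fin1 gP)).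
(* Of the terms H(N2; r - i) only i = 0 is kept. *)
rewrite big_split /= addnC leq_add2l big_ord_recl /= subr0; exact: leq_addr.
Qed.

End Main.

Theorem theorem9 (k : fieldType) (kinf : infinite_set [set: k]%classic)
    (R : homogAlg k) (M : gmod R) (bdeg : gmod R -> nat) (r : int) :
  is_bdeg bdeg -> depth_ge M 1 -> has_reg M r -> (bdeg M <= hilb M r)%N.
Proof.
move=> bdegP Mdepth [n [e [F [[e1 e_gen] Fres _ Freg]]]].
apply: (bdeg_le kinf e1 e_gen bdegP (ltnSn _) _ _ _ Mdepth).
- apply: (resolution_koszul_regular e1 Fres) => i a.
  rewrite -lerBlDr; apply: Freg; rewrite -lt0n /betti; apply/card_gt0P.
  by exists a; rewrite inE.
- exact: (resolution_locally_finite e1 Fres).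
exact: (resolution_bounded_below e1 Fres).
Qed.
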